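(* Let $K,M:[0,\infty)\to(0,\infty)$ be continuous non-decreasing functions such that: (1) there exist a continuous non-decreasing function $N:[0,\infty)\to[1,\infty)$ with $N(0)=1$ and a real number $s_0\geq0$ such that $M(s+s')\leq N(s')M(s)$ for all $s\geq s_0$, $s'\geq0$; (2) the function $s\mapsto M(s)^{-1/2}K(s)$, $s\geq0$, has positive increase; (3) for some $\alpha>0$ and $\beta>1/2$, $\ \liminf_{s\to\infty}s^{-\alpha}M(s)^{-\beta}K(s)=\infty$. Let $$c_{\alpha,\beta}=\left(\frac12+\sqrt{\frac14+\frac1\alpha}\right)\vee\left(\frac{2\beta}{2\beta-1}\right).$$ Then for any $c_1>c_{\alpha,\beta}$ there exist constants $c,C>0$ and a locally integrable function $f:[0,\infty)\to\mathbb{C}$ with bounded weak derivative such that $\hat f$ extends analytically to $\Omega_M\cup\mathbb{C}_+$, extends continuously to $\overline{\Omega_M}\cup\mathbb{C}_+$, satisfies $$|z\hat f(z)|\leq CK(|\mathrm{Im}\, z|)\quad\text{for all }z\in\Omega_M,$$ and fulfills $$\limsup_{t\to\infty}M_{K_1}^{-1}(c_1t)\,|f(t)|\geq c,$$ where $K_1(s)=sK(s)$. Moreover, one can choose $f$ in such a way that $\hat f$ extends (analytically) to a strip to the left of the imaginary axis.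
   Context: Notation: $a\vee b=\max\{a,b\}$, $\mathbb{C}_+=\{z\in\mathbb{C}:\mathrm{Re}\, z>0\}$, $\Omega_M=\{z\in\mathbb{C}: -1/M(|\mathrm{Im}\, z|)<\mathrm{Re}\, z\leq 0\}$, $\hat f(z)=\int_0^\infty e^{-zt}f(t)\,dt$ is the Laplace transform for $z\in\mathbb{C}_+$ (same symbol for extensions). $M_{K_1}(s)=M(s)\log(e\vee K_1(s))$ and $M_{K_1}^{-1}$ is its (right-continuous right-)inverse, defined for large arguments. A strip to the left of the imaginary axis is a set $\{z:-\eta<\mathrm{Re}\, z\leq0\}$ with $\eta>0$. A function $L:[0,\infty)\to(0,\infty)$ has positive increase if there exist $a>0$, $C_a\geq1$, $s_a>0$ such that $s^{-a}L(s)\leq C_aR^{-a}L(R)$ for all $s_a\leq s\leq R$. *)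

(* Defs.v *)
From HB Require Import structures.
From mathcomp Require Import all_boot all_order all_algebra.
From mathcomp Require Import all_classical all_reals all_analysis.
From mathcomp Require Import complex.

Set Implicit Arguments.
Unset Strict Implicit.
Unset Printing Implicit Defensive.

Import Order.TTheory GRing.Theory Num.Theory.
Import numFieldTopology.Exports numFieldNormedType.Exports.

Local Open Scope classical_set_scope.
Local Open Scope ring_scope.
Local Open Scope complex_scope.

(* Real functions on [0,oo) are total functions R -> R of which only the
   values on [0,oo) are ever constrained or used. *)

Definition nondecreasing0 (R : realType) (L : R -> R) : Prop :=
  forall s t : R, 0 <= s -> s <= t -> L s <= L t.

Definition continuous0 (R : realType) (L : R -> R) : Prop :=
  {within `[0, +oo[, continuous L}.

Definition positive_increase (R : realType) (L : R -> R) : Prop :=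
  exists a Ca sa : R, [/\ 0 < a, 1 <= Ca, 0 < sa &
    forall s r : R, sa <= s -> s <= r ->
      s `^ (- a) * L s <= Ca * (r `^ (- a) * L r)].

Definition M_log (R : realType) (M K1 : R -> R) (s : R) : R :=
  M s * ln (Num.max (expR 1) (K1 s)).

(* The right-continuous right-inverse of a continuous non-decreasing unbounded
   L : [0,oo) -> R maps t >= L 0 to the largest point of the level set
   {L = t}; rcinvK and rcinv_right_continuous below certify this. *)
Definition rcinv (R : realType) (L : R -> R) (t : R) : R :=
  sup [set s | 0 <= s /\ L s = t].

Lemma IVT0 (R : realType) (L : R -> R) (b v : R) :
  continuous0 L -> nondecreasing0 L -> 0 <= b -> L 0 <= v <= L b ->
  exists2 s, 0 <= s <= b & L s = v.
Proof.
move=> Lc Lm b0 /andP[Lv vL].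
have [||s] := @IVT R L 0 b v b0.
- apply: continuous_subspaceW Lc => x /=.
  by rewrite !in_itv/= andbT => /andP[].
- have L0b : L 0 <= L b by apply: Lm.
  by rewrite min_l// max_r// Lv vL.
- by rewrite in_itv/= => sb Ls; exists s.
Qed.

Lemma rcinvK (R : realType) (L : R -> R) (t : R) :
  continuous0 L -> nondecreasing0 L ->
  (forall B : R, exists2 s, 0 <= s & B <= L s) -> L 0 <= t ->
  [/\ 0 <= rcinv L t, L (rcinv L t) = t &
      forall s, 0 <= s -> L s = t -> s <= rcinv L t].
Proof.
move=> Lc Lm Lu Lt.
have [b b0 tb] := Lu (t + 1).
have ltb : t < L b by apply: lt_le_trans tb; rewrite ltrDl.
have [|s /andP[s0 sb] Ls] := @IVT0 R L b t Lc Lm b0; first by rewrite Lt ltW.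
pose S := [set s | 0 <= s /\ L s = t].
have Ss : S s by [].
have Sb : ubound S b.
  move=> x [x0 Lx]; rewrite leNgt; apply/negP => /ltW bx.
  by have := Lm _ _ b0 bx; rewrite Lx leNgt ltb.
have hsS : has_sup S by split; [exists s|exists b].
have leS x : S x -> x <= rcinv L t by move=> Sx; apply: ub_le_sup => //; exists b.
have r0 : 0 <= rcinv L t by apply: le_trans s0 (leS _ Ss).
split => //; last by move=> x x0 Lx; apply: leS.
apply/eqP; rewrite eq_le; apply/andP; split; last first.
  by rewrite -{1}Ls; apply: Lm => //; exact: leS.
rewrite leNgt; apply/negP => tL.
have [tv vL] := midf_lt tL.
have [|x /andP[x0 xr] Lx] := @IVT0 R L (rcinv L t) ((t + L (rcinv L t)) / 2) Lc Lm r0.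
  by rewrite (le_trans Lt (ltW tv)) ltW.
have xlt : x < rcinv L t.
  rewrite lt_neqAle xr andbT; apply/eqP => xe.
  by move: vL; rewrite -Lx xe ltxx.
have : rcinv L t <= x.
  apply: ge_sup; first by exists s.
  move=> y [y0 Ly]; rewrite leNgt; apply/negP => /ltW xy.
  by have := Lm _ _ x0 xy; rewrite Ly Lx leNgt tv.
by rewrite leNgt xlt.
Qed.

Lemma rcinv_right_continuous (R : realType) (L : R -> R) (t : R) :
  continuous0 L -> nondecreasing0 L ->
  (forall B : R, exists2 s, 0 <= s & B <= L s) -> L 0 <= t ->
  rcinv L x @[x --> t^'+] --> rcinv L t.
Proof.
move=> Lc Lm Lu Lt.
have [r0 Lr rmax] := rcinvK Lc Lm Lu Lt.
apply/cvgrPdist_lt => e e0.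
have re0 : 0 <= rcinv L t + e by rewrite addr_ge0// ltW.
have tu : t < L (rcinv L t + e).
  have : L (rcinv L t) <= L (rcinv L t + e)
    by apply: Lm => //; rewrite lerDl ltW.
  rewrite Lr lt_neqAle => ->; rewrite andbT.
  apply/eqP => te; have := rmax _ re0 (esym te).
  by rewrite gerDl leNgt e0.
near=> x.
have tx : t < x by near: x; exact: nbhs_right_gt.
have xu : x < L (rcinv L t + e) by near: x; exact: nbhs_right_lt.
have [x0 Lx _] := rcinvK Lc Lm Lu (le_trans Lt (ltW tx)).
have lt1 : rcinv L t < rcinv L x.
  rewrite ltNge; apply/negP => h.
  by have := Lm _ _ x0 h; rewrite Lx Lr leNgt tx.
have lt2 : rcinv L x < rcinv L t + e.
  rewrite ltNge; apply/negP => h.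
  by have := Lm _ _ re0 h; rewrite Lx leNgt xu.
by rewrite distrC gtr0_norm ?subr_gt0// ltrBlDl.
Unshelve. all: by end_near. Qed.

Definition cabs (R : realType) (z : R[i]) : R := ComplexField.Normc.normc z.

Definition cexp (R : realType) (z : R[i]) : R[i] :=
  (expR (complex.Re z))%:C * (cos (complex.Im z) +i* sin (complex.Im z)).

Definition Cplus (R : realType) : set R[i] := [set z | 0 < complex.Re z].

Definition Omega (R : realType) (M : R -> R) : set R[i] :=
  [set z | - (M `|complex.Im z|)^-1 < complex.Re z /\ complex.Re z <= 0].

Definition strip (R : realType) (eta : R) : set R[i] :=
  [set z | - eta < complex.Re z /\ complex.Re z <= 0].

(* Complex differentiability at every point; meaningful for open A. *)
Definition analytic_on (R : realType) (A : set R[i]) (F : R[i]^o -> R[i]^o)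
  : Prop := forall z : R[i]^o, A z -> derivable F z 1.

Definition Cintegral (R : realType) (D : set R) (f : R -> R[i]) : R[i] :=
  (\int[@lebesgue_measure R]_(t in D) complex.Re (f t)) +i*
  (\int[@lebesgue_measure R]_(t in D) complex.Im (f t)).

Definition Cintegrable (R : realType) (D : set R) (f : R -> R[i]) : Prop :=
  (@lebesgue_measure R).-integrable D (EFin \o (fun t => complex.Re (f t))) /\
  (@lebesgue_measure R).-integrable D (EFin \o (fun t => complex.Im (f t))).

Definition Cmeasurable (R : realType) (D : set R) (f : R -> R[i]) : Prop :=
  measurable_fun D (fun t => complex.Re (f t)) /\
  measurable_fun D (fun t => complex.Im (f t)).

Definition locally_integrable0 (R : realType) (f : R -> R[i]) : Prop :=
  forall T : R, 0 <= T -> Cintegrable `[0, T] f.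

Definition test_function (R : realType) (phi : R -> R) : Prop :=
  (forall (n : nat) (t : R), derivable (derive1n n phi) t 1) /\
  (exists a b : R, 0 < a /\ forall t, ~ (a <= t <= b) -> phi t = 0).

Definition weak_derivative (R : realType) (f g : R -> R[i]) : Prop :=
  forall phi : R -> R, test_function phi ->
    Cintegral `]0, +oo[ (fun t => f t * (derive1 phi t)%:C) =
    - Cintegral `]0, +oo[ (fun t => g t * (phi t)%:C).

Definition ess_bounded (R : realType) (g : R -> R[i]) : Prop :=
  Cmeasurable `]0, +oo[ g /\
  exists B : R,
    {ae @lebesgue_measure R, forall t : R, 0 < t -> cabs (g t) <= B}.

(* An almost-everywhere class with bounded weak derivative is identified, as
   usual, with its continuous (indeed Lipschitz) representative: continuity
   is what makes pointwise assertions about f t meaningful. *)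
Definition bounded_weak_derivative (R : realType) (f : R -> R[i]) : Prop :=
  {within `[0, +oo[, continuous (f : R -> R[i]^o)} /\
  exists g : R -> R[i], ess_bounded g /\ weak_derivative f g.

Definition laplace (R : realType) (f : R -> R[i]) (z : R[i]) : R[i] :=
  Cintegral `[0, +oo[ (fun t => cexp (- z * t%:C) * f t).

(* F is an analytic function on A `|` Cplus extending the Laplace transform. *)
Definition laplace_extension (R : realType) (f : R -> R[i]) (A : set R[i])
    (F : R[i]^o -> R[i]^o) : Prop :=
  analytic_on (A `|` @Cplus R) F /\
  forall z : R[i], @Cplus R z -> F z = laplace f z.

Definition c_alpha_beta (R : realType) (alpha beta : R) : R :=
  Num.max (2^-1 + Num.sqrt (4^-1 + alpha^-1))
          (2 * beta / (2 * beta - 1)).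

(* Main.v *)
Require Import Defs.
From mathcomp Require Import all_boot all_order all_algebra.
From mathcomp Require Import all_classical all_reals all_analysis.
From mathcomp Require Import measurable_realfun complex ring lra.

Import Order.TTheory GRing.Theory Num.Theory.
Import numFieldTopology.Exports numFieldNormedType.Exports.

(** The function is a superposition of sparse pulses
[S n ^-1 * (u * exp (1 - u)) ^ k n * exp (2 * i * S n * t)] with [u = t / T n]. The
[n]-th one has amplitude [1 / S n], frequency [2 * S n] and its peak at the time
[T n] for which [c1 * T n] is the value at [S n] of the function whose inverse
enters the claim. At this time the inverse is at least [S n], the pulse itself has
modulus [1 / S n], and the other pulses do not interfere because the sequences grow
fast ([cpulse_sum_peak]). As amplitude times frequency is bounded and the peaks are
sparse, the sum is Lipschitz.

The transform of a pulse is the rational function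
[coef / (z + lam - 2 * i * S) ^ k.+1] with [lam = k / T], so that all estimates
are algebraic. Let [L] be the logarithm of [S * K S], so that [T = M S * L / c1].

At frequencies above [S] the region has width at most [1 / M S], where the
transform is larger than on the imaginary axis by a factor of about
[exp (T / M S) = exp (L / c1)], the power [1 / c1] of [S * K S]. On the axis it is
about [w / S], where [w = T / sqrt k] is the width of the pulse. If [lam] is a
multiple of [S ^ 2], then [w] is about [sqrt T / S], and the product of [z] with the
transform is of order [sqrt (M S * L) / S * (S * K S) ^ (1 / c1)]. The growth
condition gives [M <= K ^ (1 / beta)], so this is much less than [K S] if
[1 / c1 < 1 - 1 / (2 * beta)] ([high_frequency_small]). The pulse has the frequency
[2 * S], and not [S], because then the values of [K] and [M] above [S] are all that
matters here, and monotonicity is enough to control them.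

At frequencies below [S] the region may be wider, and the growth factor is an
exponential of [T] with some fixed rate. But these frequencies are at distance [S]
from that of the pulse, and the transform decays away from [2 * i * S] like a
Gaussian of width [1 / w]. So it gains [exp (- w ^ 2 * S ^ 2 / 2)], which is the
exponential of a multiple of [- T]; this multiple is as large as wanted
([pole_low_frequency], [low_frequency_small]).

Hence the transforms sum up to an analytic function on a half plane that contains
the closure of the region in its interior, which gives both extensions
([derivable_transform_sum], [laplace_cpulse_sum], [transform_sum_growth]). *)

Set Implicit Arguments.
Unset Strict Implicit.
Unset Printing Implicit Defensive.

Local Open Scope classical_set_scope.
Local Open Scope ring_scope.
Local Open Scope complex_scope.

(** * Moduli of complex numbers *)

Section ComplexModulus.
Context {R : realType}.
Implicit Types (z w : R[i]) (x y : R).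

Lemma cabsE z : cabs z = Num.sqrt (complex.Re z ^+ 2 + complex.Im z ^+ 2).
Proof. by case: z. Qed.

Lemma cabs_normE z : `|z| = (cabs z)%:C.
Proof. by rewrite normc_def cabsE. Qed.

Lemma sqr_cabs z : cabs z ^+ 2 = complex.Re z ^+ 2 + complex.Im z ^+ 2.
Proof. by rewrite cabsE sqr_sqrtr// addr_ge0// sqr_ge0. Qed.

Lemma cabs_ge0 z : 0 <= cabs z.
Proof. by rewrite cabsE sqrtr_ge0. Qed.

Lemma cabsM z w : cabs (z * w) = cabs z * cabs w.
Proof. exact: ComplexField.Normc.normcM. Qed.

Lemma cabsV z : cabs z^-1 = (cabs z)^-1.
Proof. exact: ComplexField.Normc.normcV. Qed.

Lemma cabs0 : cabs (0 : R[i]) = 0.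
Proof. exact: ComplexField.Normc.normc0. Qed.

Lemma cabs1 : cabs (1 : R[i]) = 1.
Proof. exact: ComplexField.Normc.normc1. Qed.

Lemma cabsX z n : cabs (z ^+ n) = cabs z ^+ n.
Proof. by elim: n => [|n IH]; rewrite ?expr0 ?cabs1// !exprS cabsM IH. Qed.

Lemma cabsN z : cabs (- z) = cabs z.
Proof. by rewrite !cabsE; case: z => a b /=; rewrite !sqrrN. Qed.

Lemma cabsD z w : cabs (z + w) <= cabs z + cabs w.
Proof. by have := ler_normD z w; rewrite !cabs_normE -rmorphD/= lecR. Qed.

Lemma cabsB z w : cabs (z - w) <= cabs z + cabs w.
Proof. by rewrite (le_trans (cabsD _ _))// cabsN. Qed.

Lemma cabs_real x : cabs x%:C = `|x|.
Proof. by rewrite cabsE/= expr0n addr0 sqrtr_sqr. Qed.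

Lemma cabs_sum (I : Type) (r : seq I) (P : pred I) (u : I -> R[i]) :
  cabs (\sum_(i <- r | P i) u i) <= \sum_(i <- r | P i) cabs (u i).
Proof.
elim/big_rec2: _ => [|i y x _ h]; first by rewrite cabs0.
by rewrite (le_trans (cabsD _ _))// lerD2l.
Qed.

Lemma Re_le_cabs z : `|complex.Re z| <= cabs z.
Proof. by rewrite cabsE -sqrtr_sqr ler_wsqrtr// lerDl sqr_ge0. Qed.

Lemma Im_le_cabs z : `|complex.Im z| <= cabs z.
Proof. by rewrite cabsE -sqrtr_sqr ler_wsqrtr// lerDr sqr_ge0. Qed.

Lemma cabs_le_ReIm z : cabs z <= `|complex.Re z| + `|complex.Im z|.
Proof.
rewrite -(@ler_pXn2r _ 2)// ?nnegrE ?cabs_ge0 ?addr_ge0// sqr_cabs.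
rewrite sqrrD !real_normK ?num_real//.
by rewrite -addrA lerD2l lerDr mulrn_wge0// mulr_ge0.
Qed.

Lemma cabs_cexp z : cabs (cexp z) = expR (complex.Re z).
Proof.
rewrite /cexp cabsM cabs_real ger0_norm ?expR_ge0//.
by rewrite [X in _ * X]cabsE/= cos2Dsin2 sqrtr1 mulr1.
Qed.

Lemma cexpD z w : cexp (z + w) = cexp z * cexp w.
Proof.
case: z => a b; case: w => c d; rewrite /cexp/= expRD cosD sinD.
by apply/eqP; rewrite eq_complex/=; apply/andP; split; apply/eqP; ring.
Qed.

(** A quadratic remainder is the form of differentiability that survives
summation: remainders of the terms of a series add up. *)
Lemma derivable_of_quadratic (F : R[i]^o -> R[i]^o) (z D : R[i]) (r C : R) :
  0 < r ->
  (forall h : R[i], cabs h < r ->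
     cabs (F (z + h) - F z - h * D) <= C * cabs h ^+ 2) ->
  derivable F z 1.
Proof.
move=> r0 FD; rewrite /derivable; apply/cvg_ex; exists (D : R[i]^o).
apply/cvgrPdist_le => e e0.
have eE : e = (complex.Re e)%:C.
  by have /ger0_Im := ltW e0; case: (e) => a b /= ->.
have re0 : 0 < complex.Re e by rewrite -ltcR -eE.
have C1 : 0 < `|C| + 1 by rewrite ltr_wpDl.
pose d := Num.min r (complex.Re e / (`|C| + 1)).
have d0 : 0 < d by rewrite lt_min r0 divr_gt0.
exists d%:C => /=; first by rewrite ltcR.
move=> h /=; rewrite sub0r normrN cabs_normE ltcR lt_min => /andP[hr hd] h0.
have ch0 : 0 < cabs h.
  by rewrite lt_def cabs_ge0 andbT; apply: contra h0 => /eqP/ComplexField.Normc.eq0_normc ->.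
have -> : D - h^-1 *: (F (h *: 1 + z) - F z) = - (h^-1 * (F (z + h) - F z - h * D)).
  rewrite [h *: 1]mulr1 [h + z]addrC [h^-1 *: _]/(_ * _).
  by rewrite mulrBr mulKf// opprB.
rewrite normrN cabs_normE eE lecR cabsM cabsV.
rewrite ler_pdivrMl// (le_trans (FD _ hr))// expr2 mulrA [leRHS]mulrC.
rewrite ler_wpM2r ?cabs_ge0//.
move: hd; rewrite ltr_pdivlMr// => /ltW; apply: le_trans.
by rewrite mulrC ler_wpM2l ?cabs_ge0// (le_trans (ler_norm _))// lerDl.
Qed.

End ComplexModulus.

(** * The pulses *)

Section Peak.
Context {R : realType}.
Implicit Types (u x T t S psi : R) (k : nat).

Lemma expR1_le4 : expR 1 <= 4 :> R.
Proof.
have h : 2^-1 <= expR (- 2^-1) :> R.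
  by apply: le_trans (expR_ge1Dx _); lra.
have : 4^-1 <= expR (- 2^-1) * expR (- 2^-1) :> R.
  by apply: (@le_trans _ _ (2^-1 * 2^-1)); [lra|apply: ler_pM; lra].
rewrite -expRD (_ : - 2^-1 - 2^-1 = - 1 :> R); last by lra.
by rewrite expRN lef_pV2 ?posrE ?expR_gt0.
Qed.

(** [u * exp (1 - u)] has its maximum [1] at [u = 1]. Its [k]-th power is, up to
scaling, the density [t ^ k * exp (- lam * t)], which is concentrated in a
relative width [1 / sqrt k] and has a rational Laplace transform. *)
Definition peak u : R := u * expR (1 - u).

Lemma peak_ge0 u : 0 <= u -> 0 <= peak u.
Proof. by move=> u0; rewrite mulr_ge0// expR_ge0. Qed.

Lemma peak1 : peak 1 = 1.
Proof. by rewrite /peak subrr expR0 mulr1. Qed.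

Lemma peak_le u : 0 <= u -> peak u <= (1 + (u - 1) ^+ 2 / 27)^-1.
Proof.
move=> u0; set x := u - 1.
have ux : u = 1 + x by rewrite /x; lra.
have x1 : -1 <= x by rewrite /x; lra.
have d0 : 0 < 1 + x ^+ 2 / 27 by rewrite ltr_wpDr ?ltr01// divr_ge0 ?sqr_ge0.
rewrite /peak (_ : 1 - u = - x); last by rewrite ux; lra.
rewrite expRN ler_pdivrMr ?expR_gt0// -ler_pdivrMl ?invr_gt0// invrK mulrC.
(* three factors [1 + x / 3 <= expR (x / 3)] suffice for a quadratic gain *)
apply: (@le_trans _ _ ((1 + x / 3) ^+ 3)); last first.
  rewrite (_ : expR x = expR (x / 3) ^+ 3).
    by rewrite lerXn2r ?nnegrE ?expR_ge0 ?expR_ge1Dx//; lra.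
  by rewrite -expRM_natr; congr expR; lra.
have -> : (1 + x / 3) ^+ 3 = u * (1 + x ^+ 2 / 27) + x ^+ 2 * (8 / 27).
  by rewrite ux; field.
by rewrite lerDl mulr_ge0 ?sqr_ge0//; lra.
Qed.

Lemma peak_le1 u : 0 <= u -> peak u <= 1.
Proof.
move=> u0; apply: (le_trans (peak_le u0)).
by rewrite invf_le1 ?lerDl ?divr_ge0 ?sqr_ge0// ltr_wpDr ?ltr01// divr_ge0 ?sqr_ge0.
Qed.

(** Bernoulli's inequality turns the Gaussian-like decay of the powers into a
rational one, which is easier to sum and to optimize. *)
Lemma peakX_le u k : 0 <= u -> peak u ^+ k <= (1 + k%:R * ((u - 1) ^+ 2 / 27))^-1.
Proof.
move=> u0; set y := _ / 27.
have y0 : 0 <= y by rewrite /y divr_ge0 ?sqr_ge0.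
have d0 : 0 < 1 + y by rewrite ltr_wpDr ?ltr01.
apply: (@le_trans _ _ ((1 + y)^-1 ^+ k)).
  by rewrite lerXn2r ?nnegrE ?peak_ge0 ?invr_ge0 ?(ltW d0)// peak_le.
clearbody y.
have dk0 j : 0 < 1 + j%:R * y by rewrite (ltr_wpDr _ ltr01)// mulr_ge0 ?ler0n.
rewrite exprVn lef_pV2 ?posrE ?exprn_gt0//.
elim: k => [|k IH]; first by rewrite mul0r addr0 expr0.
rewrite exprS; apply: le_trans (ler_wpM2l (ltW d0) IH).
rewrite -natr1; have : 0 <= k%:R * (y * y) by rewrite !mulr_ge0.
by lra.
Qed.

(** By the arithmetic-geometric mean inequality, applied to the denominator in
[peakX_le]. The derivative of [peak ^ k] carries a factor [k]; this gain makes it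
of order [sqrt k], the inverse of the width of the peak. *)
Lemma absM_peakX_le u k : 0 <= u -> (0 < k)%N ->
  `|u - 1| * peak u ^+ k <= 3 / Num.sqrt k%:R.
Proof.
move=> u0 k0; set x := u - 1.
have s0 : 0 < Num.sqrt k%:R :> R by rewrite sqrtr_gt0 ltr0n.
have d0 : 0 < 1 + k%:R * (x ^+ 2 / 27).
  by rewrite ltr_wpDr ?ltr01// mulr_ge0// divr_ge0 ?sqr_ge0.
apply: (le_trans (ler_wpM2l (normr_ge0 _) (peakX_le k u0))).
rewrite ler_pdivrMr// mulrAC ler_pdivlMr// -/x.
rewrite (_ : x ^+ 2 = `|x| ^+ 2); last by rewrite real_normK ?num_real.
rewrite -[X in _ + X * _](@sqr_sqrtr _ k%:R)//.
set b := `|x| * _.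
have -> : 3 * (1 + Num.sqrt k%:R ^+ 2 * (`|x| ^+ 2 / 27)) = 3 + b ^+ 2 / 9.
  by rewrite /b; field.
have : 0 <= (b / 3 - 3 / 2) ^+ 2 by rewrite sqr_ge0.
rewrite (_ : _ ^+ 2 = b ^+ 2 / 9 - b + 9 / 4); last by field.
by lra.
Qed.

End Peak.

Section Pulse.
Context {R : realType}.
Implicit Types (x T t S psi : R) (k : nat).

Lemma eq_is_derive (f g : R -> R) x (df dg : R) :
  is_derive x (1 : R) g dg -> f =1 g -> dg = df -> is_derive x 1 f df.
Proof. by move=> dgx /funext -> <-. Qed.

Lemma is_derive_affine (a b t : R) : is_derive t (1 : R) (fun s => a * s + b) a.
Proof.
apply: (eq_is_derive (is_deriveD (is_deriveZ a (is_derive_id t (1 : R)))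
  (is_derive_cst b t (1 : R)))) => //.
by rewrite addr0 [a *: _]mulr1.
Qed.

Lemma is_derive_comp_affine (f df : R -> R) (a b t : R) :
  (forall x, is_derive x (1 : R) f (df x)) ->
  is_derive t (1 : R) (fun s => f (a * s + b)) (df (a * t + b) * a).
Proof.
move=> fdf.
exact: (@is_derive1_comp _ f (fun s => a * s + b) t _ _ (fdf _) (is_derive_affine a b t)).
Qed.

(** A wave of frequency [2 * S] and amplitude [S^-1] around the time [T]. The
phases [psi = 0] and [psi = pi / 2] give the real and imaginary parts of one
complex wave, so both are treated at once. *)
Definition pulse S T k psi t : R :=
  S^-1 * (peak (t / T) ^+ k * cos (2 * S * t - psi)).

Definition pulse' S T k psi t : R :=
  S^-1 * (k%:R / T * (1 - t / T) * expR (1 - t / T) * peak (t / T) ^+ k.-1 *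
            cos (2 * S * t - psi) -
          peak (t / T) ^+ k * (2 * S * sin (2 * S * t - psi))).

Lemma is_derive_peakX T k t :
  is_derive t 1 (fun s => peak (s / T) ^+ k)
   (k%:R / T * (1 - t / T) * expR (1 - t / T) * peak (t / T) ^+ k.-1).
Proof.
have dE : is_derive t 1 (fun s => expR (1 - s / T)) (expR (1 - t / T) * - T^-1).
  apply: (eq_is_derive (@is_derive_comp_affine expR expR (- T^-1) 1 t _)).
  - by move=> s; congr expR; ring.
  - by congr (expR _ * _); ring.
have du : is_derive t 1 (fun s => s / T) T^-1.
  apply: (eq_is_derive (is_derive_affine T^-1 0 t)) => // s.
  by rewrite addr0 mulrC.
have db : is_derive t 1 (fun s => peak (s / T)) (T^-1 * (1 - t / T) * expR (1 - t / T)).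
  apply: (eq_is_derive (is_deriveM du dE)) => //.
  by rewrite -![_ *: _]/(_ * _); ring.
apply: (eq_is_derive (is_deriveX k db)) => //.
  by move=> s; rewrite exprfctE.
by rewrite -![_ *: _]/(_ * _); ring.
Qed.

Lemma is_derive_pulse S T k psi t :
  is_derive t 1 (pulse S T k psi) (pulse' S T k psi t).
Proof.
have dc : is_derive t 1 (fun s => cos (2 * S * s - psi))
    (- sin (2 * S * t - psi) * (2 * S)).
  by apply: (@is_derive_comp_affine _ (fun x => - sin x)) => x; exact: is_derive_cos.
apply: (eq_is_derive (is_deriveZ S^-1 (is_deriveM (is_derive_peakX T k t) dc))) => //.
by rewrite -![_ *: _]/(_ * _) /pulse'; ring.
Qed.

Lemma pulse_le S T k psi t : 0 < S -> 0 < T -> 0 <= t ->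
  `|pulse S T k psi t| <= S^-1 * peak (t / T) ^+ k.
Proof.
move=> S0 T0 t0; have b0 : 0 <= peak (t / T) by rewrite peak_ge0 ?divr_ge0 ?(ltW T0).
rewrite /pulse !normrM ger0_norm ?invr_ge0 ?(ltW S0)//.
rewrite ler_wpM2l ?invr_ge0 ?(ltW S0)// [leLHS](_ : _ = peak (t / T) ^+ k * `|cos (2 * S * t - psi)|).
  by rewrite ler_piMr ?exprn_ge0// ler_norml cos_geN1 cos_le1.
by rewrite normrX (ger0_norm b0).
Qed.

Lemma pulse_leV S T k psi t : 0 < S -> 0 < T -> 0 <= t ->
  `|pulse S T k psi t| <= S^-1.
Proof.
move=> S0 T0 t0; apply: (le_trans (pulse_le _ _ S0 T0 t0)).
have u0 : 0 <= t / T by rewrite divr_ge0 ?(ltW T0).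
by rewrite ler_piMr ?invr_ge0 ?(ltW S0)// exprn_ile1 ?peak_le1 ?peak_ge0.
Qed.

(** Far behind the peak the exponential factor, of rate [k / T], dominates the
power; half of the rate pays for it. *)
Lemma peakX_late T k t : 0 < T -> 12 * T <= t ->
  peak (t / T) ^+ k <= expR (- (k%:R / T * t / 2)).
Proof.
move=> T0 tT; have t0 : 0 <= t by apply: le_trans tT; rewrite mulr_ge0// ltW.
set u := t / T; have u12 : 12 <= u by rewrite /u ler_pdivlMr.
have -> : - (k%:R / T * t / 2) = (- (u / 2)) * k%:R by rewrite /u; field; rewrite gt_eqF.
clearbody u; rewrite expRM_natr.
apply: lerXn2r; rewrite ?nnegrE ?expR_ge0 ?peak_ge0//; first by lra.
have h : u <= expR (u / 2 - 1).
  rewrite (_ : expR _ = expR (u / 4 - 2^-1) ^+ 2); last first.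
    by rewrite -expRM_natr; congr expR; lra.
  apply: (@le_trans _ _ ((1 + (u / 4 - 2^-1)) ^+ 2)); last first.
    by apply: lerXn2r; rewrite ?nnegrE ?expR_ge0 ?expR_ge1Dx//; lra.
  by nra.
rewrite /peak (_ : - (u / 2) = (u / 2 - 1) + (1 - u)); last by lra.
by rewrite [leRHS]expRD ler_wpM2r ?expR_ge0.
Qed.

Lemma pulse'_le S T k psi t : 0 < S -> 0 < T -> 0 <= t ->
  `|pulse' S T k psi t| <=
  S^-1 * (4 * (k%:R / T) * (`|t / T - 1| * peak (t / T) ^+ k.-1)) +
  2 * peak (t / T) ^+ k.
Proof.
move=> S0 T0 t0; set u := t / T.
have u0 : 0 <= u by rewrite divr_ge0 ?(ltW T0).
have b0 : 0 <= peak u by rewrite peak_ge0.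
have l0 : 0 <= k%:R / T by rewrite divr_ge0 ?(ltW T0).
have e4 : expR (1 - u) <= 4.
  by apply: le_trans expR1_le4; rewrite ler_expR; lra.
have ex0 := expR_ge0 (1 - u).
rewrite /pulse' -/u mulrBr; apply: (le_trans (ler_normB _ _)).
have cos1 x : `|cos x| <= 1 by rewrite ler_norml cos_geN1 cos_le1.
have sin1 x : `|sin x| <= 1 by rewrite ler_norml sin_geN1 sin_le1.
apply: lerD.
  rewrite normrM gtr0_norm ?invr_gt0// ler_wpM2l ?invr_ge0 ?(ltW S0)//.
  apply: (@le_trans _ _ `|k%:R / T * (1 - u) * expR (1 - u) * peak u ^+ k.-1|).
    by rewrite [leLHS]normrM ler_piMr.
  rewrite (normrM (_ * _ * _)) (normrM (_ * _)) (normrM (k%:R / T)).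
  rewrite (ger0_norm ex0) normrX (ger0_norm b0) (ger0_norm l0) distrC.
  rewrite [leLHS](_ : _ = k%:R / T * (`|u - 1| * peak u ^+ k.-1) * expR (1 - u)); last by ring.
  rewrite [leRHS](_ : _ = k%:R / T * (`|u - 1| * peak u ^+ k.-1) * 4); last by ring.
  by rewrite ler_wpM2l// mulr_ge0// mulr_ge0// exprn_ge0.
rewrite normrM gtr0_norm ?invr_gt0// ler_pdivrMl//.
rewrite !normrM normrX (ger0_norm b0) (gtr0_norm S0) (@gtr0_norm _ 2)//.
rewrite [leLHS](_ : _ = S * (2 * peak u ^+ k) * `|sin (2 * S * t - psi)|); last by ring.
by rewrite ler_piMr// !mulr_ge0 ?(ltW S0)// exprn_ge0.
Qed.

(** At the peak the oscillation contributes [2 * S / S], and the envelope, of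
width [T / sqrt k], at most a constant since [k / T] is below [S ^ 2]. *)
Lemma pulse'_bounded S T k psi t : 1 <= S -> 1 <= T -> (1 < k)%N ->
  2 * (k%:R / T) <= S ^+ 2 -> 0 <= t -> `|pulse' S T k psi t| <= 14.
Proof.
move=> S1 T1 k1 lS t0; have S0 : 0 < S by lra.
have T0 : 0 < T by lra.
have u0 : 0 <= t / T by rewrite divr_ge0 ?(ltW T0).
case: k k1 lS => [//|j]; rewrite ltnS => j0 lS.
apply: (le_trans (pulse'_le _ _ S0 T0 t0)).
have j0R : 0 < j%:R :> R by rewrite ltr0n.
have s0 : 0 < Num.sqrt j%:R :> R by rewrite sqrtr_gt0.
have bk : peak (t / T) ^+ j.+1 <= 1 by rewrite exprn_ile1 ?peak_le1 ?peak_ge0.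
have := absM_peakX_le u0 j0 => /= h.
have l0 : 0 <= j.+1%:R / T :> R by rewrite divr_ge0 ?(ltW T0).
have l1 : j.+1%:R / T <= S * Num.sqrt j%:R.
  rewrite -(@ler_pXn2r _ 2)// ?nnegrE//; last by rewrite mulr_ge0 ?ltW.
  rewrite [leRHS]exprMn sqr_sqrtr ?ler0n//.
  have l2 : j.+1%:R / T <= 2 * j%:R :> R.
    rewrite ler_pdivrMr//; apply: (@le_trans _ _ (2 * j%:R * 1)); last first.
      by rewrite ler_wpM2l// mulr_ge0.
    have : 1 <= j%:R :> R by rewrite ler1n.
    by rewrite -natr1; lra.
  rewrite expr2; apply: (@le_trans _ _ (j.+1%:R / T * (2 * j%:R))).
    by rewrite ler_wpM2l.
  by rewrite mulrCA mulrA ler_wpM2r// mulrC.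
apply: (@le_trans _ _ (12 + 2 * 1)); last by lra.
apply: lerD; last by rewrite ler_wpM2l.
rewrite ler_pdivrMl//.
apply: (@le_trans _ _ (4 * (j.+1%:R / T) * (3 / Num.sqrt j%:R))).
  by rewrite ler_wpM2l// mulr_ge0.
rewrite [leLHS]mulrA ler_pdivrMr//.
by move: l1; set s := Num.sqrt _; lra.
Qed.

(** The derivatives of different pulses do not get smaller with [S]: only away
from the peaks they do, so a superposition is Lipschitz if its peaks are sparse. *)
Lemma pulse'_off_peak S T k psi t : 1 <= S -> 1 <= T -> (1 < k)%N -> S <= k%:R ->
  0 <= t -> 2^-1 <= `|t / T - 1| -> `|pulse' S T k psi t| <= 648 / S.
Proof.
move=> S1 T1 k1 Sk t0 off; have S0 : 0 < S by lra.
have T0 : 0 < T by lra.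
have u0 : 0 <= t / T by rewrite divr_ge0 ?(ltW T0).
case: k k1 Sk => [//|j]; rewrite ltnS => j0 Sk.
apply: (le_trans (pulse'_le _ _ S0 T0 t0)) => /=.
have j0R : 1 <= j%:R :> R by rewrite ler1n.
set x := t / T - 1 in off *.
have x2 : 4^-1 <= x ^+ 2.
  rewrite -(real_normK (num_real x)) expr2.
  by apply: (@le_trans _ _ (2^-1 * 2^-1)); [lra|apply: ler_pM; lra].
have bk i : (0 < i)%N -> peak (t / T) ^+ i <= 108 / i%:R.
  move=> i0; have i0R : 0 < i%:R :> R by rewrite ltr0n.
  apply: (le_trans (peakX_le _ u0)); rewrite -/x.
  rewrite -[leRHS]invf_div lef_pV2 ?posrE ?divr_gt0//; last first.
    by rewrite ltr_wpDr// mulr_ge0 ?ler0n// divr_ge0 ?sqr_ge0.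
  apply: (@le_trans _ _ (i%:R * (x ^+ 2 / 27))); last by rewrite lerDr.
  by rewrite ler_wpM2l ?ler0n//; lra.
have xb : `|x| * peak (t / T) ^+ j <= 54 / j%:R.
  have x0 : 0 < `|x| by lra.
  apply: (@le_trans _ _ (`|x| * (j%:R * (x ^+ 2 / 27))^-1)).
    rewrite ler_wpM2l//; apply: (le_trans (peakX_le _ u0)); rewrite -/x.
    rewrite lef_pV2 ?posrE; last 2 first.
    - by rewrite ltr_wpDr// mulr_ge0 ?ler0n// divr_ge0 ?sqr_ge0.
    - by rewrite mulr_gt0 ?divr_gt0//; lra.
    by rewrite lerDr.
  rewrite -(real_normK (num_real x)) -[leLHS](_ : 27 / (j%:R * `|x|) = _); last first.
    by field; rewrite !gt_eqF//; lra.
  rewrite ler_pdivrMr ?mulr_gt0//; last by lra.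
  by rewrite mulrA divfK; [lra|rewrite gt_eqF//; lra].
have kj : j.+1%:R <= 2 * j%:R :> R by rewrite -natr1; lra.
have h1 : S^-1 * (4 * (j.+1%:R / T) * (`|x| * peak (t / T) ^+ j)) <= S^-1 * 432.
  rewrite ler_wpM2l ?invr_ge0 ?(ltW S0)//.
  apply: (@le_trans _ _ (4 * (2 * j%:R) * (54 / j%:R))); last first.
    by rewrite mulrA ler_pdivrMr; lra.
  have b0 : 0 <= peak (t / T) ^+ j by rewrite exprn_ge0// peak_ge0.
  apply: ler_pM => //; rewrite ?mulr_ge0 ?invr_ge0 ?(ltW T0)//.
  rewrite ler_wpM2l// ler_pdivrMr//.
  by apply: (le_trans kj); rewrite ler_peMr//; lra.
have h2 : 2 * peak (t / T) ^+ j.+1 <= 216 / S.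
  apply: (@le_trans _ _ (2 * (108 / S))); last by lra.
  rewrite ler_wpM2l//; apply: (le_trans (bk _ (ltn0Sn j))).
  by rewrite ler_wpM2l// lef_pV2 ?posrE ?ltr0n.
by apply: (le_trans (lerD h1 h2)); lra.
Qed.

End Pulse.

(** * Laplace transforms of powers times exponentials *)

Section HalfLineIntegrals.
Context {R : realType}.
Notation mu := (@lebesgue_measure R).

Lemma expR_ge_exprn (y : R) k : 0 <= y -> y ^+ k / k`!%:R <= expR y.
Proof.
move=> y0; case: k => [|k].
  rewrite expr0 fact0 divr1; apply: le_trans (expR_ge1Dx y); lra.
by apply: le_trans (expR_ge1Dxn k y0); rewrite lerDr.
Qed.

Lemma derive_continuous (F f : R -> R) : (forall t, is_derive t (1 : R) F (f t)) ->
  continuous F.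
Proof. by move=> Ff t; apply/differentiable_continuous/derivable1_diffP; have [] := Ff t. Qed.

Lemma ge0_integral_primitive (F f : R -> R) (l : R) :
  continuous f -> (forall t, is_derive t (1 : R) F (f t)) ->
  (forall t, 0 <= t -> 0 <= f t) -> F t @[t --> +oo] --> l ->
  (\int[mu]_(t in `[0%R, +oo[) (f t)%:E = (l - F 0)%:E)%E.
Proof.
move=> cf Ff f0 Fl.
have cF := derive_continuous Ff.
rewrite (@ge0_continuous_FTC2y R f F 0 l)//.
- exact: continuous_subspaceT.
- by apply: cvg_at_right_filter; exact: cF.
- by move=> x _; rewrite derive1E; have [] := Ff x.
Qed.

Lemma cvg_expR_decay (d : R) : 0 < d -> expR (- (d * t)) @[t --> +oo] --> 0.
Proof.
move=> d0; apply: (@cvg_comp _ _ _ (fun t => d * t) (fun y => expR (- y)) _ +oo).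
  by apply: gt0_cvgMry => //; exact: cvg_id.
exact: cvgr_expR.
Qed.

Lemma is_derive_expR_decay (d c t : R) : d != 0 ->
  is_derive t (1 : R) (fun t => - (c / d * expR (- (d * t)))) (c * expR (- (d * t))).
Proof.
move=> d0.
apply: (eq_is_derive (is_deriveZ (- (c / d)) (@is_derive_comp_affine _ expR expR (- d) 0 t (@is_derive_expR R)))).
  by move=> s; rewrite -[RHS]/(- (c / d) * expR (- d * s + 0)) addr0 !mulNr.
by rewrite addr0 mulNr -[_ *: _]/(_ * _); field.
Qed.

Lemma continuous_expR_decay (d c : R) : continuous (fun t => c * expR (- (d * t))).
Proof.
move=> t; apply: cvgM; first exact: cvg_cst.
apply: (@continuous_comp _ _ _ (fun t => - (d * t)) expR); last exact: continuous_expR.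
by apply: cvgN; apply: cvgM; [exact: cvg_cst|exact: cvg_id].
Qed.

Lemma integrable_of_integral_fin (f : R -> R) (v : R) :
  continuous f -> (forall t, 0 <= t -> 0 <= f t) ->
  (\int[mu]_(t in `[0%R, +oo[) (f t)%:E = v%:E)%E ->
  mu.-integrable `[0, +oo[ (EFin \o f).
Proof.
move=> cf f0 fv; apply/integrableP; split.
  apply/measurable_EFinP; apply: measurable_funTS.
  exact: continuous_measurable_fun.
rewrite [ltLHS](_ : _ = v%:E) ?ltry// -fv; apply: eq_integral => t.
by rewrite inE/= in_itv/= andbT => t0; rewrite ger0_norm// f0.
Qed.

Lemma expR_decay_integral (d c : R) : 0 < d -> 0 <= c ->
  (\int[mu]_(t in `[0%R, +oo[) (c * expR (- (d * t)))%:E = (c / d)%:E)%E.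
Proof.
move=> d0 c0.
rewrite (ge0_integral_primitive (l := 0) (@continuous_expR_decay d c)
  (fun t => is_derive_expR_decay c t (lt0r_neq0 d0))).
- by rewrite mulr0 oppr0 expR0 mulr1 sub0r opprK.
- by move=> t _; rewrite mulr_ge0// expR_ge0.
- rewrite -oppr0 -(mulr0 (c / d)); apply: cvgN; apply: cvgM; first exact: cvg_cst.
  exact: cvg_expR_decay.
Qed.

Lemma integrable_expR_decay (d c : R) : 0 < d -> 0 <= c ->
  mu.-integrable `[0, +oo[ (EFin \o (fun t => c * expR (- (d * t)))).
Proof.
move=> d0 c0; apply: integrable_of_integral_fin (expR_decay_integral d0 c0).
- exact: continuous_expR_decay.
- by move=> t _; rewrite mulr_ge0// expR_ge0.
Qed.

(** Adding the exponential majorant, whose primitive is explicit, makes the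
integrand nonnegative. *)
Lemma integral_primitive (F f : R -> R) (l d c : R) : 0 < d -> 0 <= c ->
  continuous f -> (forall t, is_derive t (1 : R) F (f t)) ->
  (forall t, 0 <= t -> `|f t| <= c * expR (- (d * t))) -> F t @[t --> +oo] --> l ->
  mu.-integrable `[0, +oo[ (EFin \o f) /\
  \int[mu]_(t in `[0, +oo[) f t = l - F 0.
Proof.
move=> d0 c0 cf Ff fb Fl.
pose m t := c * expR (- (d * t)).
pose g t := f t + m t.
have cg : continuous g.
  by move=> t; apply: cvgD; [exact: cf|exact: continuous_expR_decay].
have g0 t : 0 <= t -> 0 <= g t.
  by move=> /fb; rewrite ler_norml /g /m => /andP[h _]; lra.
have Fg t : is_derive t (1 : R) (fun t => F t + - (c / d * expR (- (d * t)))) (g t).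
  exact: is_deriveD (Ff t) (is_derive_expR_decay c t (lt0r_neq0 d0)).
have lg : F t + - (c / d * expR (- (d * t))) @[t --> +oo] --> l.
  rewrite -[l]addr0; apply: cvgD => //.
  rewrite -oppr0 -(mulr0 (c / d)); apply: cvgN; apply: cvgM; first exact: cvg_cst.
  exact: cvg_expR_decay.
have gE := ge0_integral_primitive cg Fg g0 lg.
have ig := integrable_of_integral_fin cg g0 gE.
have im := integrable_expR_decay d0 c0.
have fE : f = fun t => g t - m t by apply/funext => t; rewrite /g addrK.
have if_ : mu.-integrable `[0, +oo[ (EFin \o f).
  rewrite fE; apply: eq_integrable (integrableB _ ig im) => //; exact: measurable_itv.
split => //; rewrite fE RintegralB//.
rewrite /Rintegral gE expR_decay_integral//= mulr0 oppr0 expR0.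
by lra.
Qed.

End HalfLineIntegrals.

Section LaplacePowers.
Context {R : realType}.
Implicit Types (H h : R -> R[i]) (w : R[i]).

Lemma cReM (x y : R[i]) : complex.Re (x * y) =
  complex.Re x * complex.Re y - complex.Im x * complex.Im y.
Proof. by case: x; case: y. Qed.

Lemma cImM (x y : R[i]) : complex.Im (x * y) =
  complex.Re x * complex.Im y + complex.Im x * complex.Re y.
Proof. by case: x; case: y. Qed.

Lemma Re_cexp (z : R[i]) :
  complex.Re (cexp z) = expR (complex.Re z) * cos (complex.Im z).
Proof. by rewrite /cexp cReM /= mul0r subr0. Qed.

Lemma Im_cexp (z : R[i]) :
  complex.Im (cexp z) = expR (complex.Re z) * sin (complex.Im z).
Proof. by rewrite /cexp cImM /= mul0r addr0. Qed.

(** Derivative of a complex function of a real variable; [h] is a function, and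
not its value at [t], so that constructions on [H] and [h] run in parallel. *)
Definition cderiv H h (t : R) :=
  is_derive t (1 : R) (fun s => complex.Re (H s)) (complex.Re (h t)) /\
  is_derive t (1 : R) (fun s => complex.Im (H s)) (complex.Im (h t)).

Lemma eq_cderiv H h h' t : cderiv H h t -> h t = h' t -> cderiv H h' t.
Proof. by rewrite /cderiv => + <-. Qed.

Definition cvanish H :=
  complex.Re (H t) @[t --> +oo] --> 0 /\ complex.Im (H t) @[t --> +oo] --> 0.

Lemma cderivD H h G g t : cderiv H h t -> cderiv G g t ->
  cderiv (fun s => H s + G s) (fun s => h s + g s) t.
Proof.
move=> [H1 H2] [G1 G2]; split.
- apply: (eq_is_derive (is_deriveD H1 G1)) => [s|]; last by rewrite raddfD.
  by rewrite raddfD.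
- apply: (eq_is_derive (is_deriveD H2 G2)) => [s|]; last by rewrite raddfD.
  by rewrite raddfD.
Qed.

Lemma cderivMl H h w t : cderiv H h t -> cderiv (fun s => w * H s) (fun s => w * h s) t.
Proof.
move=> [H1 H2]; split.
- apply: (eq_is_derive (is_deriveB (is_deriveZ (complex.Re w) H1)
    (is_deriveZ (complex.Im w) H2))) => [s|]; by rewrite cReM.
- apply: (eq_is_derive (is_deriveD (is_deriveZ (complex.Re w) H2)
    (is_deriveZ (complex.Im w) H1))) => [s|]; by rewrite cImM.
Qed.

Lemma cderiv_scale (r r' : R -> R) H h t : is_derive t (1 : R) r (r' t) ->
  cderiv H h t ->
  cderiv (fun s => (r s)%:C * H s) (fun s => (r' s)%:C * H s + (r s)%:C * h s) t.
Proof.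
move=> dr [H1 H2]; split.
- apply: (eq_is_derive (is_deriveM dr H1)) => [s|].
    by rewrite cReM/= mul0r subr0.
  by rewrite raddfD/= !cReM/= !mul0r !subr0 addrC mulrC.
- apply: (eq_is_derive (is_deriveM dr H2)) => [s|].
    by rewrite cImM/= mul0r addr0.
  by rewrite raddfD/= !cImM/= !mul0r !addr0 addrC mulrC.
Qed.

Lemma cderiv_cexp (w : R[i]) t :
  cderiv (fun s => cexp (- (w * s%:C))) (fun s => - w * cexp (- (w * s%:C))) t.
Proof.
case: w => a b.
have dE : is_derive t (1 : R) (fun s => expR (- a * s + 0)) (expR (- a * t + 0) * - a).
  exact: (@is_derive_comp_affine _ expR expR).
have dc : is_derive t (1 : R) (fun s => cos (- b * s + 0)) (- sin (- b * t + 0) * - b).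
  by apply: (@is_derive_comp_affine _ cos (fun x => - sin x)) => x; exact: is_derive_cos.
have ds : is_derive t (1 : R) (fun s => sin (- b * s + 0)) (cos (- b * t + 0) * - b).
  by apply: (@is_derive_comp_affine _ sin cos) => x; exact: is_derive_sin.
have re s : complex.Re (- ((a +i* b) * s%:C)) = - a * s + 0.
  by rewrite /= mulr0 subr0 mulNr addr0.
have im s : complex.Im (- ((a +i* b) * s%:C)) = - b * s + 0.
  by rewrite /= mulr0 add0r mulNr addr0.
split.
- apply: (eq_is_derive (is_deriveM dE dc)) => [s|].
    by rewrite Re_cexp re im.
  by rewrite cReM Re_cexp Im_cexp re im -![_ *: _]/(_ * _)/=; ring.
- apply: (eq_is_derive (is_deriveM dE ds)) => [s|].
    by rewrite Im_cexp re im.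
  by rewrite cImM Re_cexp Im_cexp re im -![_ *: _]/(_ * _)/=; ring.
Qed.

Lemma cvanishD H G : cvanish H -> cvanish G -> cvanish (fun s => H s + G s).
Proof.
move=> [H1 H2] [G1 G2]; split; rewrite -[0]addr0.
- by under eq_fun do rewrite raddfD; exact: cvgD.
- by under eq_fun do rewrite raddfD; exact: cvgD.
Qed.

Lemma cvanishMl H w : cvanish H -> cvanish (fun s => w * H s).
Proof.
move=> [H1 H2]; split.
- under eq_fun do rewrite cReM.
  rewrite -[0](_ : complex.Re w * 0 - complex.Im w * 0 = 0); last by ring.
  by apply: cvgB; apply: cvgMr.
- under eq_fun do rewrite cImM.
  rewrite -[0](_ : complex.Re w * 0 + complex.Im w * 0 = 0); last by ring.
  by apply: cvgD; apply: cvgMr.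
Qed.

Lemma exprn_expR_decay (a t : R) k : 0 < a -> 0 <= t ->
  t ^+ k * expR (- (a * t)) <= k`!%:R * (2 / a) ^+ k * expR (- (a / 2 * t)).
Proof.
move=> a0 t0.
have y0 : 0 <= a / 2 * t by rewrite mulr_ge0 ?divr_ge0 ?(ltW a0).
have := expR_ge_exprn k y0.
rewrite ler_pdivrMr ?ltr0n ?fact_gt0// => h.
have -> : - (a * t) = - (a / 2 * t) + - (a / 2 * t) by field.
rewrite expRD mulrA ler_wpM2r ?expR_ge0//.
rewrite expRN ler_pdivrMr ?expR_gt0//.
have -> : t ^+ k = (2 / a) ^+ k * (a / 2 * t) ^+ k.
  by rewrite -exprMn; congr (_ ^+ k); field; rewrite gt_eqF.
rewrite [leRHS](_ : _ = (2 / a) ^+ k * (expR (a / 2 * t) * k`!%:R)); last by ring.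
by rewrite ler_wpM2l// exprn_ge0// divr_ge0// ltW.
Qed.

Lemma cabs_pow_cexp (w : R[i]) k t : 0 < complex.Re w -> 0 <= t ->
  cabs ((t ^+ k)%:C * cexp (- (w * t%:C))) <=
  k`!%:R * (2 / complex.Re w) ^+ k * expR (- (complex.Re w / 2 * t)).
Proof.
move=> w0 t0; rewrite cabsM cabs_real cabs_cexp ger0_norm ?exprn_ge0//.
rewrite (_ : complex.Re (- (w * t%:C)) = - (complex.Re w * t)).
  exact: exprn_expR_decay.
by case: (w) => a b /=; rewrite mulr0 subr0.
Qed.

Lemma cvanish_decay H (c d : R) : 0 < d ->
  (forall t, 0 <= t -> cabs (H t) <= c * expR (- (d * t))) -> cvanish H.
Proof.
move=> d0 Hd.
have lim0 : c * expR (- (d * t)) @[t --> +oo] --> 0.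
  by rewrite -(mulr0 c); apply: cvgM; [exact: cvg_cst|exact: cvg_expR_decay].
have sq (g : R -> R) : (forall t, `|g t| <= cabs (H t)) -> g t @[t --> +oo] --> 0.
  move=> gH; apply: (@squeeze_cvgr _ _ _ _ (fun t => - (c * expR (- (d * t))))
    (fun t => c * expR (- (d * t)))) => //.
  - exists 0; split => // t /ltW t0.
    by rewrite -ler_norml (le_trans (gH t))// Hd.
  - by rewrite -oppr0; exact: cvgN.
by split; apply: sq => t; [exact: Re_le_cabs|exact: Im_le_cabs].
Qed.

(** Integration by parts, in the form of a recursion on primitives. *)
Lemma pow_cexp_primitive (w : R[i]) k : 0 < complex.Re w ->
  exists H : R -> R[i], [/\
    forall t, cderiv H (fun s => (s ^+ k)%:C * cexp (- (w * s%:C))) t,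
    H 0 = - (k`!%:R / w ^+ k.+1) & cvanish H].
Proof.
move=> w0; have wn : w != 0.
  by apply: contraL w0 => /eqP ->; rewrite ltxx.
have E0 : cexp (- (w * 0%:C)) = 1.
  by rewrite mulr0 oppr0 /cexp/= expR0 cos0 sin0 mul1r.
elim: k => [|k [H [dH H0 vH]]].
  exists (fun s => - w^-1 * cexp (- (w * s%:C))); split.
  - move=> t; apply: (eq_cderiv (cderivMl (- w^-1) (cderiv_cexp w t))).
    by rewrite expr0; field.
  - by rewrite E0 mulr1 fact0 expr1 div1r.
  - apply: cvanishMl; apply: (@cvanish_decay _ _ (complex.Re w / 2)).
      by rewrite divr_gt0.
    by move=> t t0; have := @cabs_pow_cexp w 0%N t w0 t0; rewrite expr0 mul1r; exact.
exists (fun s => w^-1 * (- 1 * ((s ^+ k.+1)%:C * cexp (- (w * s%:C))) + k.+1%:R * H s)).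
split.
- move=> t.
  have dX : is_derive t (1 : R) (fun s => s ^+ k.+1) (k.+1%:R * t ^+ k).
    apply: (eq_is_derive (is_deriveX k.+1 (is_derive_id t (1 : R)))) => [s|].
      by rewrite exprfctE.
    by rewrite [LHS]mulr1.
  apply: (eq_cderiv (cderivMl w^-1 (cderivD (cderivMl (- 1) (cderiv_scale
    (r' := fun t => k.+1%:R * t ^+ k) dX (cderiv_cexp w t))) (cderivMl k.+1%:R (dH t))))).
  by rewrite rmorphM rmorph_nat/=; field.
- rewrite H0 expr0n/= mul0r mulr0 add0r factS natrM !exprS.
  have wk : w ^+ k != 0 by rewrite expf_neq0. by field; rewrite ?wk ?wn.
- apply: cvanishMl; apply: cvanishD; apply: cvanishMl => //.
  apply: (@cvanish_decay _ _ (complex.Re w / 2)); first by rewrite divr_gt0.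
  by move=> t t0; exact: cabs_pow_cexp.
Qed.

Lemma laplace_pow (w : R[i]) k : 0 < complex.Re w ->
  Cintegrable `[0, +oo[ (fun t : R => (t ^+ k)%:C * cexp (- (w * t%:C))) /\
  Cintegral `[0, +oo[ (fun t : R => (t ^+ k)%:C * cexp (- (w * t%:C))) =
    k`!%:R / w ^+ k.+1.
Proof.
move=> w0; have [H [dH H0 [vr vi]]] := pow_cexp_primitive k w0.
pose h t : R[i] := (t ^+ k)%:C * cexp (- (w * t%:C)).
have d0 : 0 < complex.Re w / 2 by rewrite divr_gt0.
have c0 : 0 <= k`!%:R * (2 / complex.Re w) ^+ k.
  by rewrite mulr_ge0// exprn_ge0// divr_ge0// ltW.
have dh t : cderiv h (fun s => (k%:R * s ^+ k.-1)%:C * cexp (- (w * s%:C)) +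
    (s ^+ k)%:C * (- w * cexp (- (w * s%:C)))) t.
  apply: (cderiv_scale (r' := fun t => k%:R * t ^+ k.-1)) (cderiv_cexp w t).
  apply: (eq_is_derive (is_deriveX k (is_derive_id t (1 : R)))) => [s|].
    by rewrite exprfctE.
  by rewrite [LHS]mulr1.
have [ir er] := integral_primitive d0 c0 (derive_continuous (fun t => proj1 (dh t)))
  (fun t => proj1 (dH t))
  (fun t t0 => le_trans (Re_le_cabs _) (cabs_pow_cexp k w0 t0)) vr.
have [ii ei] := integral_primitive d0 c0 (derive_continuous (fun t => proj2 (dh t)))
  (fun t => proj2 (dH t))
  (fun t t0 => le_trans (Im_le_cabs _) (cabs_pow_cexp k w0 t0)) vi.
split; first by split.
rewrite /Cintegral er ei H0 !sub0r.
by case: (_ / _) => x y /=; rewrite !opprK.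
Qed.

End LaplacePowers.

(** * Series of complex numbers *)

(** Summation is done on real and imaginary parts, so that convergence rests on
the completeness of [R]. *)
Definition csum {R : realType} (u : nat -> R[i]) : R[i] :=
  limn (series (fun n => complex.Re (u n))) +i*
  limn (series (fun n => complex.Im (u n))).

Section ComplexSeries.
Context {R : realType}.

Lemma series_cvg_bounded (u b : R^nat) (B : R) :
  (forall n, `|u n| <= b n) -> (forall N, series b N <= B) -> cvgn (series u).
Proof.
move=> ub bB; apply: normed_cvg.
apply: nondecreasing_is_cvgn.
  by apply: nondecreasing_series => n _ _ /=.
exists B => _ [N _ <-]; apply: le_trans (bB N).
by apply: ler_sum => i _; exact: ub.
Qed.

Lemma Re_sum (I : Type) (r : seq I) (P : pred I) (u : I -> R[i]) :
  complex.Re (\sum_(i <- r | P i) u i) = \sum_(i <- r | P i) complex.Re (u i).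
Proof. by elim/big_rec2: _ => [//|i y x _ <-]; case: x; case: (u i). Qed.

Lemma Im_sum (I : Type) (r : seq I) (P : pred I) (u : I -> R[i]) :
  complex.Im (\sum_(i <- r | P i) u i) = \sum_(i <- r | P i) complex.Im (u i).
Proof. by elim/big_rec2: _ => [//|i y x _ <-]; case: x; case: (u i). Qed.

Definition ccvg (u : nat -> R[i]) (l : R[i]) :=
  complex.Re (u n) @[n --> \oo] --> complex.Re l /\
  complex.Im (u n) @[n --> \oo] --> complex.Im l.

Lemma ccvg_csum (u : nat -> R[i]) (b : R^nat) (B : R) :
  (forall n, cabs (u n) <= b n) -> (forall N, series b N <= B) ->
  ccvg (series u) (csum u).
Proof.
move=> ub bB; split.
- under eq_fun do rewrite Re_sum.
  apply: (@series_cvg_bounded (fun n => complex.Re (u n)) b B) => // n.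
  exact: le_trans (Re_le_cabs _) (ub n).
- under eq_fun do rewrite Im_sum.
  apply: (@series_cvg_bounded (fun n => complex.Im (u n)) b B) => // n.
  exact: le_trans (Im_le_cabs _) (ub n).
Qed.

Lemma ccvgB u v a b : ccvg u a -> ccvg v b -> ccvg (fun n => u n - v n) (a - b).
Proof.
move=> [ua1 ua2] [vb1 vb2]; split.
- under eq_fun do rewrite raddfB.
  by rewrite raddfB; exact: cvgB.
- under eq_fun do rewrite raddfB.
  by rewrite raddfB; exact: cvgB.
Qed.

Lemma ccvgMl u a (w : R[i]) : ccvg u a -> ccvg (fun n => w * u n) (w * a).
Proof.
have ReM (x y : R[i]) : complex.Re (x * y) =
    complex.Re x * complex.Re y - complex.Im x * complex.Im y.
  by case: x; case: y.
have ImM (x y : R[i]) : complex.Im (x * y) =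
    complex.Re x * complex.Im y + complex.Im x * complex.Re y.
  by case: x; case: y.
move=> [ua1 ua2]; split.
- under eq_fun do rewrite ReM.
  by rewrite ReM; apply: cvgB; apply: cvgMr.
- under eq_fun do rewrite ImM.
  by rewrite ImM; apply: cvgD; apply: cvgMr.
Qed.

Lemma ccvg_cabs_le u a (B : R) : ccvg u a -> (forall n, cabs (u n) <= B) ->
  cabs a <= B.
Proof.
move=> [ua1 ua2] uB.
have B0 : 0 <= B by apply: le_trans (uB 0%N); exact: cabs_ge0.
rewrite -(@ler_pXn2r _ 2)// ?nnegrE ?cabs_ge0// sqr_cabs !expr2.
have fa : complex.Re (u n) * complex.Re (u n) + complex.Im (u n) * complex.Im (u n)
    @[n --> \oo] --> complex.Re a * complex.Re a + complex.Im a * complex.Im a.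
  by apply: cvgD; apply: cvgM.
rewrite -(cvg_lim _ fa)//; apply: limr_le; first by apply/cvg_ex; eexists; exact: fa.
apply: nearW => n; rewrite /= -!expr2 -sqr_cabs.
by rewrite ler_pXn2r// ?nnegrE ?cabs_ge0.
Qed.

End ComplexSeries.

Section InversePowers.
Context {R : realType}.
Implicit Types (p q h : R[i]) (P : R).

Lemma inv_pow_lipschitz p q h P m : p - q = - h * p * q ->
  cabs p <= P -> cabs q <= P ->
  cabs (p ^+ m - q ^+ m) <= m%:R * cabs h * P ^+ m.+1.
Proof.
move=> pq pP qP; have P0 : 0 <= P := le_trans (cabs_ge0 _) pP.
elim: m => [|m IH]; first by rewrite !expr0 subrr cabs0 !mul0r.
have -> : p ^+ m.+1 - q ^+ m.+1 = p ^+ m * (p - q) + q * (p ^+ m - q ^+ m).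
  by rewrite exprSr exprS; ring.
rewrite pq (le_trans (cabsD _ _))// !cabsM cabsN cabsX.
have -> : m.+1%:R * cabs h * P ^+ m.+2 =
    P ^+ m * (cabs h * P * P) + P * (m%:R * cabs h * P ^+ m.+1).
  by rewrite -natr1 !exprS; ring.
apply: lerD; last by rewrite ler_pM ?cabs_ge0.
rewrite ler_pM ?exprn_ge0 ?mulr_ge0 ?cabs_ge0//.
  by rewrite lerXn2r// ?nnegrE ?cabs_ge0.
by rewrite ler_pM ?mulr_ge0 ?cabs_ge0// ler_pM ?cabs_ge0.
Qed.

(** With [q = x^-1] and [p = (x + h)^-1], the left-hand side is the Taylor
remainder of [x ^- m] for the increment [h]. *)
Lemma inv_pow_remainder p q h P m : p - q = - h * p * q ->
  cabs p <= P -> cabs q <= P ->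
  cabs (p ^+ m - q ^+ m - h * (- m%:R * q ^+ m.+1)) <=
    m%:R ^+ 2 * cabs h ^+ 2 * P ^+ m.+2.
Proof.
move=> pq pP qP; have P0 : 0 <= P := le_trans (cabs_ge0 _) pP.
elim: m => [|m IH].
  by rewrite !expr0 subrr oppr0 mul0r mulr0 subr0 cabs0 expr0n !mul0r.
have -> : p ^+ m.+1 - q ^+ m.+1 - h * (- m.+1%:R * q ^+ m.+2) =
   q * (p ^+ m - q ^+ m - h * (- m%:R * q ^+ m.+1)) -
     h * (q * (p ^+ m.+1 - q ^+ m.+1)).
  have e : p ^+ m * (p - q) = p ^+ m * (- h * p * q) by rewrite pq.
  rewrite -natr1 !exprS.
  apply/eqP; rewrite -subr_eq0; apply/eqP.
  transitivity (p ^+ m * (p - q) - p ^+ m * (- h * p * q)); first by ring.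
  by rewrite e subrr.
rewrite (le_trans (cabsB _ _))//.
have h1 : cabs (q * (p ^+ m - q ^+ m - h * (- m%:R * q ^+ m.+1))) <=
    P * (m%:R ^+ 2 * cabs h ^+ 2 * P ^+ m.+2).
  by rewrite cabsM ler_pM ?cabs_ge0.
have h2 : cabs (h * (q * (p ^+ m.+1 - q ^+ m.+1))) <=
    cabs h * (P * (m.+1%:R * cabs h * P ^+ m.+2)).
  rewrite cabsM ler_wpM2l ?cabs_ge0// cabsM ler_pM ?cabs_ge0//.
  exact: inv_pow_lipschitz.
apply: le_trans (lerD h1 h2) _.
have -> : m.+1%:R ^+ 2 * cabs h ^+ 2 * P ^+ m.+3 =
   P * (m%:R ^+ 2 * cabs h ^+ 2 * P ^+ m.+2) +
   cabs h * (P * (m.+1%:R * cabs h * P ^+ m.+2)) + m%:R * (cabs h ^+ 2 * P ^+ m.+3).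
  by rewrite -natr1 !exprS; ring.
rewrite lerDl; apply: mulr_ge0; first exact: ler0n.
by rewrite mulr_ge0 ?sqr_ge0// exprn_ge0.
Qed.

(** The factor [m ^ 2] in the majorant pays for two differentiations of the
[m]-th power, so that the quadratic remainders of the terms can be summed. *)
Lemma derivable_csum_inv_pow (c : R^nat) (a : nat -> R[i]) (m : nat -> nat)
    (z : R[i]) (r : R) (b : R^nat) (B : R) :
  0 < r -> (forall n, 0 <= c n) -> (forall n, (0 < m n)%N) ->
  (forall n h, cabs h < r -> 1 <= cabs (z + h + a n)) ->
  (forall n h, cabs h < r ->
     c n * (m n)%:R ^+ 2 * (cabs (z + h + a n))^-1 ^+ m n <= b n) ->
  (forall N, series b N <= B) ->
  derivable ((fun z => csum (fun n => (c n)%:C * (z + a n)^-1 ^+ m n))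
             : R[i]^o -> R[i]^o) z 1.
Proof.
move=> r0 c0 m0 ge1 bnd bB.
pose q h n := (z + h + a n)^-1.
pose D := csum (fun n => (c n)%:C * (- (m n)%:R * (q 0 n) ^+ (m n).+1)).
have ler1 h n : cabs h < r -> cabs (q h n) <= 1.
  move=> hr; rewrite cabsV invf_le1; first exact: ge1.
  by rewrite (lt_le_trans ltr01)// ge1.
have c00 : cabs (0 : R[i]) < r by rewrite cabs0.
have m1 n : 1 <= (m n)%:R :> R by rewrite ler1n.
have cF h : cabs h < r ->
  ccvg (series (fun n => (c n)%:C * (q h n) ^+ m n))
       (csum (fun n => (c n)%:C * (q h n) ^+ m n)).
  move=> hr; apply: (ccvg_csum _ bB) => n.
  apply: le_trans (bnd n h hr); rewrite cabsM cabs_real ger0_norm// cabsX cabsV.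
  rewrite ler_wpM2r ?exprn_ge0 ?invr_ge0 ?cabs_ge0//.
  by rewrite ler_peMr// exprn_ege1.
have cD : ccvg (series (fun n => (c n)%:C * (- (m n)%:R * (q 0 n) ^+ (m n).+1))) D.
  apply: (ccvg_csum _ bB) => n.
  apply: le_trans (bnd n 0 c00).
  rewrite cabsM cabs_real ger0_norm// -mulrA ler_wpM2l//.
  rewrite cabsM cabsN -[X in cabs X](rmorph_nat (real_complex R)).
  rewrite cabs_real ger0_norm// exprSr cabsM cabsX cabsV.
  rewrite ler_pM// ?mulr_ge0 ?exprn_ge0 ?invr_ge0 ?cabs_ge0//.
    by rewrite expr2 ler_peMr// ler0n.
  by rewrite ler_piMr ?exprn_ge0 ?invr_ge0 ?cabs_ge0// -cabsV; exact: ler1.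
apply: (@derivable_of_quadratic _ _ _ D r (B + B)) => // h hr.
have cc := ccvgB (ccvgB (cF h hr) (cF 0 c00)) (ccvgMl h cD).
have -> : csum (fun n => (c n)%:C * (z + a n)^-1 ^+ m n) =
          csum (fun n => (c n)%:C * (q 0 n) ^+ m n).
  by congr csum; apply/funext => n; rewrite /q addr0.
apply: (ccvg_cabs_le cc) => N.
rewrite /series/= mulr_sumr -!sumrB.
apply: le_trans (cabs_sum _ _ _) _.
rewrite mulrDl.
have h20 : 0 <= cabs h ^+ 2 by rewrite sqr_ge0.
apply: le_trans (lerD (ler_wpM2r h20 (bB N)) (ler_wpM2r h20 (bB N))).
rewrite -mulrDl /series/= -big_split/= mulr_suml ler_sum// => n _.
set P := Num.max (cabs (q h n)) (cabs (q 0 n)).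
have qP : q h n - q 0 n = - h * q h n * q 0 n.
  have nz x : 1 <= cabs x -> x != 0 :> R[i].
    by move=> x1; apply/eqP => x0; move: x1; rewrite x0 cabs0 lt_geF.
  have z1 := nz _ (ge1 n h hr); have z2 := nz _ (ge1 n 0 c00).
  move: z2; rewrite /q addr0 => z2; have -> : z + h + a n = z + a n + h by ring.
  have z3 : z + a n + h != 0 by rewrite addrAC.
  by field; rewrite z2 z3.
have := @inv_pow_remainder _ _ _ P (m n) qP.
rewrite !le_max !lexx orbT => /(_ isT isT) rem.
have -> : (c n)%:C * q h n ^+ m n - (c n)%:C * q 0 n ^+ m n -
    h * ((c n)%:C * (- (m n)%:R * q 0 n ^+ (m n).+1)) =
   (c n)%:C * (q h n ^+ m n - q 0 n ^+ m n - h * (- (m n)%:R * q 0 n ^+ (m n).+1)).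
  by ring.
rewrite cabsM cabs_real ger0_norm//.
apply: le_trans (ler_wpM2l (c0 n) rem) _.
have P0 : 0 <= P by rewrite le_max cabs_ge0.
have P1 : P <= 1 by rewrite ge_max !ler1.
have PP : P ^+ (m n).+2 <= cabs (q h n) ^+ m n + cabs (q 0 n) ^+ m n.
  apply: (@le_trans _ _ (P ^+ m n)); first by apply: ler_wiXn2l => //; rewrite -addn2 leq_addr.
  rewrite /P; case: (leP (cabs (q h n))) => _.
    by rewrite lerDr exprn_ge0// cabs_ge0.
  by rewrite lerDl exprn_ge0// cabs_ge0.
have := lerD (bnd n h hr) (bnd n 0 c00).
rewrite -mulrDr -!cabsV => /(ler_wpM2r h20); apply: le_trans.
have -> : c n * ((m n)%:R ^+ 2 * cabs h ^+ 2 * P ^+ (m n).+2) =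
    c n * (m n)%:R ^+ 2 * (P ^+ (m n).+2 * cabs h ^+ 2) by ring.
rewrite -[leRHS]mulrA; apply: ler_wpM2l.
  by apply: mulr_ge0 => //; exact: sqr_ge0.
by apply: ler_wpM2r.
Qed.

End InversePowers.

(** * Termwise integration *)

Section Dominated.
Context d (T : measurableType d) (R : realType) (mu : {measure set T -> \bar R}).

Lemma Rintegral_dominated_cvg (D : set T) (f_ : nat -> T -> R) (f g : T -> R) :
  measurable D -> (forall n, mu.-integrable D (EFin \o f_ n)) ->
  (forall x, D x -> f_ n x @[n --> \oo] --> f x) ->
  mu.-integrable D (EFin \o g) ->
  (forall n x, D x -> `|f_ n x| <= g x) ->
  mu.-integrable D (EFin \o f) /\
  \int[mu]_(x in D) f_ n x @[n --> \oo] --> \int[mu]_(x in D) f x.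
Proof.
move=> mD if_ ff ig fg.
have mf_ n : measurable_fun D (EFin \o f_ n) by have /integrableP[] := if_ n.
have eff x : D x -> (EFin \o f_ n) x @[n --> \oo] --> (f x)%:E.
  by move=> Dx; apply/cvg_EFin; [exact: nearW|exact: ff].
have mf : measurable_fun D (EFin \o f) by exact: emeasurable_fun_cvg mf_ eff.
have efg : forall n x, D x -> (`|(EFin \o f_ n) x| <= (EFin \o g) x)%E.
  by move=> n x Dx; rewrite /= lee_fin fg.
have [||intf _ intcvg] := @dominated_convergence _ _ _ mu D mD (fun n => EFin \o f_ n) (EFin \o f) (EFin \o g) mf_ mf _ ig.
- exact: aeW.
- by apply: aeW => /= x n; exact: efg.
split => //; apply: fine_cvg; rewrite fineK//; exact: integrable_fin_num.
Qed.

Lemma integrable_sum (D : set T) (f_ : nat -> T -> R) N : measurable D ->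
  (forall n, mu.-integrable D (EFin \o f_ n)) ->
  mu.-integrable D (EFin \o (fun x => \sum_(0 <= n < N) f_ n x)).
Proof.
move=> mD if_; elim: N => [|N IH].
  apply: eq_integrable (integrable0 _ _) => // x _ /=.
  by rewrite big_nil.
apply: eq_integrable (integrableD mD IH (if_ N)) => // x _ /=.
by rewrite big_nat_recr.
Qed.

Lemma Rintegral_sum (D : set T) (f_ : nat -> T -> R) N : measurable D ->
  (forall n, mu.-integrable D (EFin \o f_ n)) ->
  \int[mu]_(x in D) (\sum_(0 <= n < N) f_ n x) =
  \sum_(0 <= n < N) \int[mu]_(x in D) f_ n x.
Proof.
move=> mD if_; elim: N => [|N IH].
  under eq_Rintegral do rewrite big_nil.
  by rewrite big_nil /Rintegral integral0.
under eq_Rintegral do rewrite big_nat_recr//=.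
by rewrite RintegralD//; [rewrite IH big_nat_recr|exact: integrable_sum].
Qed.

End Dominated.

Section ComplexTermwise.
Context {R : realType}.

Lemma ccvg_unique (u : nat -> R[i]) a b : ccvg u a -> ccvg u b -> a = b.
Proof.
move=> [a1 a2] [b1 b2].
have := cvg_unique _ a1 b1; have := cvg_unique _ a2 b2.
by case: a {a1 a2} => ? ?; case: b {b1 b2} => ? ? /= -> // ->.
Qed.

Lemma ccvg_Cintegral_series (u : nat -> R -> R[i]) (v : R -> R[i]) (c d : R) :
  0 < d -> 0 <= c ->
  (forall n, Cintegrable `[0, +oo[ (u n)) ->
  (forall t, 0 <= t -> ccvg (series (u ^~ t)) (v t)) ->
  (forall N t, 0 <= t -> cabs (series (u ^~ t) N) <= c * expR (- (d * t))) ->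
  ccvg (series (fun n => Cintegral `[0, +oo[ (u n))) (Cintegral `[0, +oo[ v).
Proof.
move=> d0 c0 iu uv ub.
have ie := integrable_expR_decay d0 c0.
have D0 (t : R) : [set` `[0, +oo[%R] t -> 0 <= t by rewrite /= in_itv/= andbT.
split.
- have iN n : (@lebesgue_measure R).-integrable `[0, +oo[
      (EFin \o (fun t => complex.Re (series (u ^~ t) n))).
    under [X in EFin \o X]eq_fun do rewrite /series/= Re_sum.
    by apply: integrable_sum; [exact: measurable_itv|move=> m; exact: (iu m).1].
  have := Rintegral_dominated_cvg _ iN _ ie.
  move=> /(_ (fun t => complex.Re (v t))) [].
  + exact: measurable_itv.
  + by move=> t /D0 /uv[].
  + by move=> n t /D0 t0; exact: le_trans (Re_le_cabs _) (ub n t t0).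
  move=> _; set L := (X in X @ _ --> _ -> _); move=> h.
  rewrite [X in X @ _](_ : _ = L)//; apply/funext => n; rewrite /L Re_sum.
  under eq_Rintegral do rewrite /series/= Re_sum.
  by rewrite Rintegral_sum// => m; exact: (iu m).1.
- have iN n : (@lebesgue_measure R).-integrable `[0, +oo[
      (EFin \o (fun t => complex.Im (series (u ^~ t) n))).
    under [X in EFin \o X]eq_fun do rewrite /series/= Im_sum.
    by apply: integrable_sum; [exact: measurable_itv|move=> m; exact: (iu m).2].
  have := Rintegral_dominated_cvg _ iN _ ie.
  move=> /(_ (fun t => complex.Im (v t))) [].
  + exact: measurable_itv.
  + by move=> t /D0 /uv[].
  + by move=> n t /D0 t0; exact: le_trans (Im_le_cabs _) (ub n t t0).
  move=> _; set L := (X in X @ _ --> _ -> _); move=> h.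
  rewrite [X in X @ _](_ : _ = L)//; apply/funext => n; rewrite /L Im_sum.
  under eq_Rintegral do rewrite /series/= Im_sum.
  by rewrite Rintegral_sum// => m; exact: (iu m).2.
Qed.

End ComplexTermwise.

(** * Series of smooth functions with bounded derivatives *)

Lemma norm_lim_le {R : realType} (u : R^nat) (l B : R) :
  u n @[n --> \oo] --> l -> (forall n, `|u n| <= B) -> `|l| <= B.
Proof.
move=> ul uB; have c : `|u n| @[n --> \oo] --> `|l| by exact: cvg_norm.
rewrite -(cvg_lim _ c)//; apply: limr_le; first by apply/cvg_ex; eexists; exact: c.
exact: nearW.
Qed.

Section SeriesOfC1.
Context {R : realType}.
Notation mu := (@lebesgue_measure R).
Variables (h h' : nat -> R -> R) (s : R^nat) (A B : R).
Hypothesis dh : forall n t, is_derive t (1 : R) (h n) (h' n t).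
Hypothesis ch' : forall n, continuous (h' n).
Hypothesis hs : forall n t, 0 <= t -> `|h n t| <= s n.
Hypothesis sA : forall N, series s N <= A.
Hypothesis h'B : forall N t, 0 <= t -> \sum_(0 <= n < N) `|h' n t| <= B.

(** The series is evaluated at [Num.max t 0]: only there it is known to
converge, and this extension to the left keeps the sum continuous. *)
Definition hsum (t : R) : R := limn (series (h ^~ (Num.max t 0))).

Definition hsum' (t : R) : R := limn (series (h' ^~ t)).

Lemma hsum_cvg t : 0 <= t -> series (h ^~ t) n @[n --> \oo] --> hsum t.
Proof.
move=> t0; rewrite /hsum max_l//.
by apply: (@series_cvg_bounded _ (h ^~ t) s A) => // n; exact: hs.
Qed.

Lemma hsum'_cvg t : 0 <= t -> series (h' ^~ t) n @[n --> \oo] --> hsum' t.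
Proof.
move=> t0; apply: (@series_cvg_bounded _ (h' ^~ t) (fun n => `|h' n t|) B) => // N.
exact: h'B.
Qed.

Lemma series_h_le t N : 0 <= t -> `|series (h ^~ t) N| <= A.
Proof.
move=> t0; apply: le_trans (sA N); apply: le_trans (ler_norm_sum _ _ _) _.
by apply: ler_sum => n _; exact: hs.
Qed.

Lemma series_h'_le t N : 0 <= t -> `|series (h' ^~ t) N| <= B.
Proof. by move=> t0; apply: le_trans (h'B N t0); apply: ler_norm_sum. Qed.

Lemma hsum'_le t : 0 <= t -> `|hsum' t| <= B.
Proof.
by move=> t0; apply: (norm_lim_le (hsum'_cvg t0)) => n; exact: series_h'_le.
Qed.

Lemma is_derive_series_h N t :
  is_derive t (1 : R) (fun t => series (h ^~ t) N) (series (h' ^~ t) N).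
Proof.
rewrite /series/=; elim: N => [|N IH].
  rewrite big_nil; apply: (eq_is_derive (is_derive_cst 0 t (1 : R))) => // x.
  by rewrite big_nil.
rewrite big_nat_recr//=; apply: (eq_is_derive (is_deriveD IH (dh N t))) => // x.
by rewrite big_nat_recr.
Qed.

Lemma continuous_series_h N : continuous (fun t => series (h ^~ t) N).
Proof. exact: derive_continuous (is_derive_series_h N). Qed.

Lemma continuous_series_h' N : continuous (fun t => series (h' ^~ t) N).
Proof.
rewrite /series/=; elim: N => [|N IH].
  by under eq_fun do rewrite big_nil; exact: cst_continuous.
under eq_fun do rewrite big_nat_recr//=.
by move=> t; apply: cvgD; [exact: IH|exact: ch'].
Qed.

Lemma hsum_lipschitz t u : `|hsum t - hsum u| <= B * `|t - u|.
Proof.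
wlog tu : t u / t <= u.
  by move=> hw; case: (leP t u) => [|/ltW] h0; [|rewrite distrC (distrC t)]; exact: hw.
have pos x : hsum x = hsum (Num.max x 0) by rewrite /hsum -maxA maxxx.
have B0 : 0 <= B.
  by apply: le_trans (h'B 0%N (lexx 0)); rewrite big_geq.
rewrite (pos t) (pos u).
set x := Num.max t 0; set y := Num.max u 0.
have x0 : 0 <= x by rewrite le_max lexx orbT.
have y0 : 0 <= y by rewrite le_max lexx orbT.
have xy : x <= y by rewrite /x /y ge_max !le_max tu lexx !orbT.
have xytu : `|x - y| <= `|t - u|.
  rewrite distrC (distrC t) !ger0_norm ?subr_ge0//.
  by rewrite /x /y; case: (leP t 0); case: (leP u 0); lra.
apply: le_trans (ler_wpM2l B0 xytu).
have c : series (h ^~ x) n - series (h ^~ y) n @[n --> \oo] --> hsum x - hsum y.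
  by apply: cvgB; exact: hsum_cvg.
apply: (norm_lim_le c) => N.
have [z zxy e] := @MVT_segment R (fun t => series (h ^~ t) N) (fun t => series (h' ^~ t) N)
  x y xy (fun z _ => is_derive_series_h N z)
  (continuous_subspaceT (@continuous_series_h N)).
have z0 : 0 <= z by move: zxy; rewrite in_itv/= => /andP[/(le_trans x0)].
rewrite distrC (distrC x) e normrM ler_wpM2r//; exact: series_h'_le.
Qed.

Lemma hsum_continuous : continuous hsum.
Proof.
move=> t; apply/cvgrPdist_le => e e0.
have B0 : 0 <= B.
  by apply: le_trans (h'B 0%N (lexx 0)); rewrite big_geq.
have B1 : 0 < B + 1 by rewrite ltr_wpDl.
exists (e / (B + 1)) => /=; first by rewrite divr_gt0.
move=> u /= tu; apply: le_trans (hsum_lipschitz t u) _.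
rewrite ltr_pdivlMr// in tu; apply: le_trans (ltW tu).
by rewrite mulrC ler_wpM2l// lerDl.
Qed.

Lemma measurable_hsum' : measurable_fun (`]0%R, +oo[ : set R) hsum'.
Proof.
apply: (@measurable_fun_cvg _ _ _ _ (fun N t => series (h' ^~ t) N)) => //.
- move=> N; apply: measurable_funTS; apply: continuous_measurable_fun.
  exact: continuous_series_h'.
- by move=> t; rewrite /= in_itv/= andbT => /ltW /hsum'_cvg.
Qed.

(** Only bounds for the partial sums of the derivatives are available, not
uniform convergence, so the sum need not be differentiable; but integration by
parts for the partial sums passes to the limit by dominated convergence on an
interval containing the support of the test function. *)
Lemma hsum_weak_derivative (phi : R -> R) : test_function phi ->
  \int[mu]_(t in `]0, +oo[) (hsum t * derive1 phi t) =
  - \int[mu]_(t in `]0, +oo[) (hsum' t * phi t).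
Proof.
move=> [phiC [a [b [a0 phi0]]]].
have dphi t : derivable phi t 1 by exact: (phiC 0%N t).
have dphi' t : derivable (derive1 phi) t 1 by exact: (phiC 1%N t).
have cphi : continuous phi.
  by move=> t; apply/differentiable_continuous/derivable1_diffP.
have cphi' : continuous (derive1 phi).
  by move=> t; apply/differentiable_continuous/derivable1_diffP.
pose l := a / 2; pose r := Num.max a b + 1.
have l0 : 0 < l by rewrite divr_gt0.
have la : l < a by rewrite /l; lra.
have br : b < r by rewrite /r ltr_pwDr// le_max lexx orbT.
have ar : a < r by rewrite /r ltr_pwDr// le_max lexx.
have lr : l < r by apply: lt_trans ar.
have off t : ~ (l < t < r) -> phi t = 0.
  move=> tlr; apply: phi0 => /andP[at_ tb]; apply: tlr.
  by rewrite (lt_le_trans la)// (le_lt_trans tb).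
have off' t : ~ (l <= t <= r) -> (derive1 phi) t = 0.
  move=> tlr; rewrite derive1E (@near_eq_derive _ _ _ _ (cst 0)) ?derive_cst//.
  have /orP[tl|tr] : (t < l) || (r < t).
    by rewrite !ltNge -negb_and; apply/negP.
  - near=> x; apply: off => /andP[lx _].
    suff : x < l by rewrite ltNge (ltW lx).
    by near: x; exact: lt_nbhsl.
  - near=> x; apply: off => /andP[_ xr].
    suff : r < x by rewrite ltNge (ltW xr).
    by near: x; exact: lt_nbhsr.
have loc (G : R -> R) : (forall t, ~ (l <= t <= r) -> G t = 0) ->
    \int[mu]_(t in `]0, +oo[) G t = \int[mu]_(t in `[l, r]) G t.
  move=> G0; rewrite Rintegral_mkcond [RHS]Rintegral_mkcond.
  congr Rintegral; apply/funext => t; rewrite !patchE.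
  case: ifPn => h1; case: ifPn => h2 //.
  - by apply: G0; move: h2; rewrite notin_setE/= in_itv.
  - exfalso; move: h1; rewrite notin_setE/= in_itv/= andbT; apply.
    move: h2; rewrite inE/= in_itv/= => /andP[lt_ _].
    exact: lt_le_trans lt_.
rewrite !loc; last 2 first.
- by move=> t tlr; rewrite off ?mulr0// => /andP[h1 h2]; apply: tlr; rewrite !ltW.
- by move=> t tlr; rewrite off' ?mulr0.
have lrC : {subset `[l, r] <= `]0, +oo[}.
  by move=> t; rewrite !in_itv/= andbT => /andP[lt_ _]; exact: lt_le_trans lt_.
have pos (t : R) : [set` `[l, r]] t -> 0 <= t.
  by move=> /lrC; rewrite in_itv/= andbT => /ltW.
have cci (G : R -> R) : continuous G -> mu.-integrable `[l, r] (EFin \o G).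
  move=> cG; apply: continuous_compact_integrable; first exact: segment_compact.
  exact: continuous_subspaceT.
have cM (f g : R -> R) : continuous f -> continuous g -> continuous (fun t => f t * g t).
  by move=> cf cg t; apply: cvgM; [exact: cf|exact: cg].
have cA (c : R) (f : R -> R) : continuous f -> continuous (fun t => c * `|f t|).
  move=> cf t; apply: cvgM; first exact: cvg_cst.
  by apply: cvg_norm; exact: cf.
have c1 : \int[mu]_(t in `[l, r]) (series (h ^~ t) N * derive1 phi t) @[N --> \oo] -->
    \int[mu]_(t in `[l, r]) (hsum t * derive1 phi t).
  apply: (@Rintegral_dominated_cvg _ _ R mu `[l, r] _ _ (fun t => A * `|derive1 phi t|)
    _ _ _ _ _).2.
  - exact: measurable_itv.
  - by move=> N; apply/cci/cM => //; exact: continuous_series_h.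
  - by move=> t /pos t0; apply: cvgM; [exact: hsum_cvg|exact: cvg_cst].
  - exact/cci/cA.
  - by move=> N t /pos t0; rewrite normrM ler_wpM2r// series_h_le.
have c2 : \int[mu]_(t in `[l, r]) (series (h' ^~ t) N * phi t) @[N --> \oo] -->
    \int[mu]_(t in `[l, r]) (hsum' t * phi t).
  apply: (@Rintegral_dominated_cvg _ _ R mu `[l, r] _ _ (fun t => B * `|phi t|)
    _ _ _ _ _).2.
  - exact: measurable_itv.
  - by move=> N; apply/cci/cM => //; exact: continuous_series_h'.
  - by move=> t /pos t0; apply: cvgM; [exact: hsum'_cvg|exact: cvg_cst].
  - exact/cci/cA.
  - by move=> N t /pos t0; rewrite normrM ler_wpM2r// series_h'_le.
have LR (f df : R -> R) : (forall t, is_derive t (1 : R) f (df t)) ->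
    derivable_oo_LRcontinuous f l r.
  move=> fdf; have cf := derive_continuous fdf; split.
  - by move=> t _; have [] := fdf t.
  - by apply: cvg_at_right_filter; exact: cf.
  - by apply: cvg_at_left_filter; exact: cf.
have phid t : is_derive t (1 : R) phi ((derive1 phi) t).
  by rewrite derive1E; exact: derivableP.
have parts N : \int[mu]_(t in `[l, r]) (series (h ^~ t) N * (derive1 phi) t) =
    - \int[mu]_(t in `[l, r]) (series (h' ^~ t) N * phi t).
  have FE : {in `]l, r[, derive1 (fun t => series (h ^~ t) N) =1
      (fun t => series (h' ^~ t) N)}.
    by move=> t _; rewrite derive1E; have [] := is_derive_series_h N t.
  have -> := Rintegration_by_parts lr
    (continuous_subspaceT (@continuous_series_h' N)) (LR _ _ (is_derive_series_h N)) FE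
    (continuous_subspaceT cphi') (LR _ _ phid) (fun t _ => erefl).
  rewrite (off l) ?(off r) ?mulr0 ?subrr ?sub0r//.
    by rewrite ltxx andbF.
  by rewrite ltxx.
have c3 : \int[mu]_(t in `[l, r]) (series (h ^~ t) N * derive1 phi t) @[N --> \oo] -->
    - \int[mu]_(t in `[l, r]) (hsum' t * phi t).
  by rewrite (funext parts); exact: cvgN.
exact: (cvg_unique _ c1 c3).
Unshelve. all: by end_near. Qed.

End SeriesOfC1.

(** * Choice of the parameters of a pulse *)

Section Stirling.
Context {R : realType}.

(** That is [exp (2 * y) <= (1 + y) / (1 - y)]; the difference of the two sides
vanishes at [0] and has the nonnegative derivative [y * (exp y - exp (- y))]. *)
Lemma expR_artanh_le (y : R) : 0 <= y -> (1 - y) * expR y <= (1 + y) * expR (- y).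
Proof.
move=> y0.
pose f (t : R) := (1 + t) * expR (- t) - (1 - t) * expR t.
have df t : is_derive t (1 : R) f (t * (expR t - expR (- t))).
  have d1 := is_derive_affine (1 : R) 1 t; have d2 := is_derive_affine (-1 : R) 1 t.
  have d3 := @is_derive_comp_affine _ expR expR (-1 : R) 0 t (@is_derive_expR R).
  apply: (eq_is_derive (is_deriveB (is_deriveM d1 d3) (is_deriveM d2 (is_derive_expR t)))).
    move=> x; rewrite /f -[RHS]/((1 * x + 1) * expR (-1 * x + 0) - (-1 * x + 1) * expR x).
    by rewrite addr0 mulN1r mul1r (addrC 1) (addrC 1).
  by rewrite -![_ *: _]/(_ * _) !addr0 !mulN1r mul1r; ring.
have [c] := @MVT_segment R f _ 0 y y0 (fun x _ => df x)
  (continuous_subspaceT (derive_continuous df)).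
have f0 : f 0 = 0 by rewrite /f oppr0 expR0; lra.
rewrite in_itv/= f0 !subr0 => /andP[c0 _] fy.
rewrite -subr_ge0 -/(f y) fy; do 2! (apply: mulr_ge0 => //).
by rewrite subr_ge0 ler_expR; lra.
Qed.

(** The quotient of the two sides is nonincreasing in [k]; by squaring, this is
[expR_artanh_le] for [y = 1 / (2 * k + 1)]. *)
Lemma fact_stirling_le k : (0 < k)%N ->
  k`!%:R * expR 1 ^+ k <= 4 * Num.sqrt k%:R * k%:R ^+ k :> R.
Proof.
elim: k => // -[_ _|k IH _].
  by rewrite -[1`!]/1%N !expr1 mul1r sqrtr1 !mulr1 expR1_le4.
have {}IH := IH isT; set n := k.+1 in IH *.
have n0 : 0 < n%:R :> R by rewrite ltr0n.
have n10 : 0 < n.+1%:R :> R by rewrite ltr0n.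
have step : expR 1 * (Num.sqrt n%:R * n%:R ^+ n) <= Num.sqrt n.+1%:R * n.+1%:R ^+ n :> R.
  rewrite -(@ler_pXn2r _ 2)// ?nnegrE ?mulr_ge0 ?expR_ge0 ?sqrtr_ge0 ?exprn_ge0 ?ler0n//.
  have sq (a : R) : 0 <= a -> (Num.sqrt a * a ^+ n) ^+ 2 = a ^+ (2 * n).+1.
    by move=> a0; rewrite exprMn sqr_sqrtr// -exprM mulnC exprS.
  rewrite [leLHS]exprMn !sq ?ler0n//.
  pose y : R := (2 * n%:R + 1)^-1.
  have d0 : 0 < 2 * n%:R + 1 :> R by lra.
  have y0 : 0 <= y by rewrite invr_ge0 ltW.
  have := expR_artanh_le y0.
  have -> : 1 - y = 2 * n%:R * y by rewrite /y; field; rewrite gt_eqF.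
  have -> : 1 + y = 2 * n.+1%:R * y by rewrite /y -natr1; field; rewrite gt_eqF.
  have y0' : 0 < 2 * y by rewrite mulr_gt0// invr_gt0.
  rewrite expRN ler_pdivlMr ?expR_gt0//.
  rewrite [leLHS](_ : _ = 2 * y * (n%:R * (expR y * expR y))); last by ring.
  rewrite [leRHS](_ : _ = 2 * y * n.+1%:R); last by ring.
  rewrite ler_pM2l// -expRD => h.
  have {}h : (n%:R * expR (y + y)) ^+ (2 * n).+1 <= n.+1%:R ^+ (2 * n).+1 :> R.
    by apply: lerXn2r => //; rewrite nnegrE ?mulr_ge0 ?expR_ge0 ?ler0n.
  move: h; rewrite exprMn -expRM_natr.
  have -> : (y + y) * (2 * n).+1%:R = 1 + 1.
    by rewrite -natr1 natrM /y; field; rewrite gt_eqF.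
  by rewrite expRD mulrC.
have -> : n.+1`!%:R * expR 1 ^+ n.+1 = n.+1%:R * expR 1 * (n`!%:R * expR 1 ^+ n) :> R.
  by rewrite factS natrM exprSr; ring.
have -> : 4 * Num.sqrt n.+1%:R * n.+1%:R ^+ n.+1 =
    4 * n.+1%:R * (Num.sqrt n.+1%:R * n.+1%:R ^+ n) :> R.
  by rewrite exprSr; ring.
apply: (@le_trans _ _ (4 * n.+1%:R * (expR 1 * (Num.sqrt n%:R * n%:R ^+ n)))).
  rewrite [leRHS](_ : _ = n.+1%:R * expR 1 * (4 * Num.sqrt n%:R * n%:R ^+ n)); last by ring.
  by rewrite ler_wpM2l// mulr_ge0 ?expR_ge0// ltW.
by rewrite ler_wpM2l// mulr_ge0// ltW.
Qed.

End Stirling.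

Section PulseTransformBounds.
Context {R : realType}.
Implicit Types (S T B eta : R) (k : nat) (z : R[i]).

(** The transform of a pulse is [pulse_coef / (z + pulse_pole) ^ k.+1]. *)
Definition pulse_coef S T k : R := S^-1 * (expR 1 / T) ^+ k * k`!%:R.

Definition pulse_pole S T k : R[i] := (k%:R / T) +i* (- (2 * S)).

Lemma pulse_coef_ge0 S T k : 0 < S -> 0 < T -> 0 <= pulse_coef S T k.
Proof.
move=> S0 T0; rewrite /pulse_coef !mulr_ge0 ?invr_ge0 ?(ltW S0)// exprn_ge0//.
by rewrite divr_ge0 ?expR_ge0 ?(ltW T0).
Qed.

(** Stirling's formula makes the coefficient comparable with [(k / T) ^ k], up to
the factor [sqrt k] that reflects the width of the pulse. *)
Lemma pulse_coef_le S T k : 0 < S -> 0 < T -> (0 < k)%N ->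
  pulse_coef S T k <= 4 * S^-1 * Num.sqrt k%:R * (k%:R / T) ^+ k.
Proof.
move=> S0 T0 k0; rewrite /pulse_coef !expr_div_n.
have Tk : 0 < (T ^+ k)^-1 by rewrite invr_gt0 exprn_gt0.
rewrite [leLHS](_ : _ = S^-1 * (T ^+ k)^-1 * (k`!%:R * expR 1 ^+ k)); last by ring.
rewrite [leRHS](_ : _ = S^-1 * (T ^+ k)^-1 * (4 * Num.sqrt k%:R * k%:R ^+ k)); last by ring.
rewrite ler_wpM2l ?fact_stirling_le// mulr_ge0 ?(ltW Tk)//.
by rewrite invr_ge0 ltW.
Qed.

Lemma expR_half_le (y : R) : 0 <= y <= 1 -> expR (y / 2) <= 1 + y.
Proof.
move=> /andP[y0 y1]; have := expR_ge1Dx (- (y / 2)).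
rewrite expRN -lef_pV2 ?posrE ?invr_gt0 ?expR_gt0//; last by lra.
rewrite invrK => h; apply: (le_trans h).
by rewrite -div1r ler_pdivrMr; nra.
Qed.

(** Below the frequency [S] the distance to the pole [- k / T + i * 2 * S] is
longer than [k / T] by a factor of about [1 + B * T / (2 * k)], because the
vertical distance [S] outweighs the horizontal approach [eta]. Its [k]-th power is
an exponential gain in [T], with a constant [B] as large as wanted if [k / T] is a
small enough multiple of [S ^ 2]. *)
Lemma pole_low_frequency S T k B eta z : 0 < T -> (0 < k)%N -> 0 <= eta ->
  eta <= k%:R / T -> 0 <= B -> B <= k%:R / T -> 0 <= S ->
  (B + 2 * eta) * (k%:R / T) <= S ^+ 2 ->
  `|complex.Im z| <= S -> - eta <= complex.Re z ->
  (cabs (z + pulse_pole S T k))^-1 ^+ k.+1 <=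
    (k%:R / T)^-1 ^+ k.+1 * expR (- (B * T / 4)).
Proof.
move=> T0 k0 eta0 etal B0 Bl S0 BS zS zeta; set lam := k%:R / T in etal Bl BS *.
have l0 : 0 < lam by rewrite divr_gt0 ?ltr0n.
have kl : k%:R = lam * T by rewrite /lam divfK// gt_eqF.
set r := cabs _.
have r2 : lam ^+ 2 * expR (B / lam / 2) <= r ^+ 2.
  have y1 : 0 <= B / lam <= 1 by rewrite divr_ge0 ?(ltW l0)//= ler_pdivrMr// mul1r.
  have l20 : 0 <= lam ^+ 2 by rewrite exprn_ge0// ltW.
  apply: (le_trans (ler_wpM2l l20 (expR_half_le y1))).
  rewrite [leLHS](_ : _ = lam ^+ 2 + B * lam); last by field; rewrite gt_eqF.
  rewrite /r sqr_cabs.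
  move: zS zeta; case: (z) => x y /=; rewrite ler_norml => /andP[y1' y2'] xe.
  rewrite -/lam; have : (lam - eta) ^+ 2 <= (x + lam) ^+ 2.
    by apply: lerXn2r; rewrite ?nnegrE; lra.
  have : S ^+ 2 <= (y - 2 * S) ^+ 2.
    by rewrite -[leRHS]sqrrN; apply: lerXn2r; rewrite ?nnegrE; lra.
  have := sqr_ge0 eta.
  by rewrite sqrrB; move: BS; lra.
have rp : 0 < r.
  rewrite lt_def cabs_ge0 andbT; apply/eqP => re0.
  by move: r2; rewrite re0 expr0n/= leNgt mulr_gt0 ?expR_gt0 ?exprn_gt0.
have rm : lam ^+ k.+1 * expR (B * T / 4) <= r ^+ k.+1.
  rewrite -(@ler_pXn2r _ 2)// ?nnegrE ?mulr_ge0 ?exprn_ge0 ?expR_ge0 ?cabs_ge0 ?(ltW l0)//.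
  rewrite exprAC; apply: (@le_trans _ _ ((lam ^+ 2 * expR (B / lam / 2)) ^+ k.+1)); last first.
    apply: lerXn2r => //; rewrite nnegrE ?sqr_ge0//.
    by apply: mulr_ge0; rewrite ?sqr_ge0 ?expR_ge0.
  have e : (lam ^+ k.+1) ^+ 2 = (lam ^+ 2) ^+ k.+1 by rewrite -!exprM mulnC.
  rewrite [leLHS]exprMn [leRHS]exprMn e ler_wpM2l//.
    by apply: exprn_ge0; exact: sqr_ge0.
  rewrite -!expRM_natr ler_expR -[k.+1%:R]natr1 kl.
  rewrite [leRHS](_ : _ = B * T / 4 * 2 + B / lam / 2); last by field; rewrite gt_eqF.
  by rewrite lerDl !divr_ge0// ltW.
by rewrite expRN !exprVn -invfM lef_pV2 ?posrE ?mulr_gt0 ?exprn_gt0 ?expR_gt0.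
Qed.

(** The factor [z] costs only [S], also at frequencies far above [S]: there the
power of the pole decays, by Bernoulli, on the scale [rho / sqrt k <= S]. *)
Lemma pole_high_frequency S T k x0 z : 0 < T -> (0 < k)%N -> 0 < S ->
  0 <= x0 -> x0 < k%:R / T -> x0 <= S -> (k%:R / T) ^+ 2 <= S ^+ 2 * k%:R ->
  - x0 <= complex.Re z -> complex.Re z <= 0 ->
  cabs z * (cabs (z + pulse_pole S T k))^-1 ^+ k.+1 <=
    4 * S * (k%:R / T - x0)^-1 ^+ k.+1.
Proof.
move=> T0 k0 S0 x00 x0l x0S lS zx z0; set lam := k%:R / T in x0l lS *.
set rho := lam - x0; have rho0 : 0 < rho by rewrite /rho; lra.
set r := cabs (z + _).
pose tau := complex.Im z - 2 * S.
have r2 : rho ^+ 2 + tau ^+ 2 <= r ^+ 2.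
  rewrite /r sqr_cabs /tau.
  move: zx; case: (z) => x y /= xe; rewrite -/lam lerD2r.
  by apply: lerXn2r; rewrite ?nnegrE /rho; lra.
have rr : rho <= r.
  rewrite -(@ler_pXn2r _ 2)// ?nnegrE ?cabs_ge0 ?(ltW rho0)//.
  by apply: le_trans r2; rewrite lerDl sqr_ge0.
have r0 : 0 < r by apply: lt_le_trans rr.
have rm : rho ^+ k.+1 <= r ^+ k.+1.
  by apply: lerXn2r => //; rewrite nnegrE ltW.
have tm : `|tau| * rho ^+ k.+1 <= S * r ^+ k.+1.
  rewrite -(@ler_pXn2r _ 2)// ?nnegrE ?mulr_ge0 ?exprn_ge0 ?(ltW r0) ?(ltW S0) ?(ltW rho0)//.
  rewrite [leLHS]exprMn [leRHS]exprMn real_normK ?num_real// [X in _ * X <= _]exprAC [X in _ <= _ * X]exprAC.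
  apply: (@le_trans _ _ (S ^+ 2 * (rho ^+ 2 + tau ^+ 2) ^+ k.+1)); last first.
    apply: ler_wpM2l; first exact: sqr_ge0.
    by apply: lerXn2r; rewrite ?nnegrE ?addr_ge0 ?sqr_ge0.
  set a := rho ^+ 2; set b := tau ^+ 2.
  have a0 : 0 < a by rewrite exprn_gt0.
  have b0 : 0 <= b by rewrite sqr_ge0.
  (* the term that is linear in [b] in the binomial expansion *)
  have bern : k.+1%:R * a ^+ k * b <= (a + b) ^+ k.+1.
    elim: (k) => [|n IH]; first by rewrite expr0 !mul1r expr1 lerDr ltW.
    rewrite [leRHS]exprS [leRHS]mulrDl.
    have h1 : a * (n.+1%:R * a ^+ n * b) <= a * (a + b) ^+ n.+1 by rewrite ler_wpM2l// ltW.
    have h2 : b * a ^+ n.+1 <= b * (a + b) ^+ n.+1.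
      rewrite ler_wpM2l//; apply: lerXn2r; rewrite ?nnegrE ?(ltW a0) ?addr_ge0 ?(ltW a0)//.
      by rewrite lerDl.
    apply: le_trans (lerD h1 h2).
    by rewrite -[n.+2%:R]natr1 exprS le_eqVlt; apply/orP; left; apply/eqP; ring.
  apply: le_trans (ler_wpM2l (sqr_ge0 S) bern).
  have -> : b * a ^+ k.+1 = a * (a ^+ k * b) by rewrite exprS; ring.
  rewrite [leRHS](_ : _ = S ^+ 2 * k.+1%:R * (a ^+ k * b)); last by ring.
  apply: ler_wpM2r; first by rewrite mulr_ge0// exprn_ge0// ltW.
  apply: (@le_trans _ _ (lam ^+ 2)).
    by rewrite /a; apply: lerXn2r; rewrite ?nnegrE /rho; lra.
  apply: (le_trans lS); rewrite ler_wpM2l ?sqr_ge0// ler_nat.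
  exact: leqnSn.
have zt : cabs z <= `|tau| + 3 * S.
  apply: (le_trans (cabs_le_ReIm z)).
  have h1 : `|complex.Re z| <= S by rewrite ler_norml; lra.
  have h2 : `|complex.Im z| <= `|tau| + 2 * S.
    rewrite [X in `|X|](_ : _ = tau + 2 * S); last by rewrite /tau; ring.
    by apply: (le_trans (ler_normD _ _)); rewrite (@ger0_norm _ (2 * S))//; lra.
  lra.
rewrite !exprVn ler_pdivrMr ?exprn_gt0// mulrAC ler_pdivlMr ?exprn_gt0//.
apply: (@le_trans _ _ ((`|tau| + 3 * S) * rho ^+ k.+1)).
  by rewrite ler_wpM2r ?exprn_ge0// ltW.
rewrite mulrDl; have := ler_wpM2l (mulr_ge0 (ler0n _ 3) (ltW S0)) rm.
by move: tm; set p := rho ^+ _; set q := r ^+ _; lra.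
Qed.

End PulseTransformBounds.

Section ParameterChoice.
Context {R : realType}.

(** Here [Mv] and [Kv] stand for the values at [S] of the two given functions, and
[M0] for a lower bound of [Mv]. By [gp_time] and [gp_e], [S] is in the level set of
[c1 * T] for the logarithmically modified function; [gp_low] and [gp_high] control
the transform, and the other fields control the pulse itself and its interaction
with the others. The factor [k.+1 ^ 2] in [gp_low] is what
[derivable_csum_inv_pow] asks for. *)
Record good_pulse (M0 c1 eta delta Mv Kv S T : R) (k : nat) : Prop := GoodPulse {
  gp_S : 4 <= S;
  gp_T : 1 <= T;
  gp_k : (1 < k)%N;
  gp_Sk : S <= k%:R;
  gp_rate_le : 2 * (k%:R / T) <= S ^+ 2;
  gp_eta : eta + 1 <= k%:R / T;
  gp_rate : 2 * c1 / M0 <= k%:R / T;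
  gp_time : Mv * ln (S * Kv) = c1 * T;
  gp_e : expR 1 <= S * Kv;
  gp_lnS : ln S <= c1 / M0 * T;
  gp_off : 648 / S <= delta;
  gp_low : forall z : R[i], `|complex.Im z| <= S -> - eta <= complex.Re z ->
    pulse_coef S T k * k.+1%:R ^+ 2 * (cabs (z + pulse_pole S T k))^-1 ^+ k.+1
      <= delta;
  gp_high : forall z : R[i], - Mv^-1 <= complex.Re z -> complex.Re z <= 0 ->
    cabs z * (pulse_coef S T k * (cabs (z + pulse_pole S T k))^-1 ^+ k.+1)
      <= delta * Kv }.

Lemma le_sqr_expR (y : R) : 0 <= y -> y ^+ 2 / 2 <= expR y.
Proof. by move=> y0; have := expR_ge_exprn 2 y0. Qed.

(** Since [S <= exp (c1 * T / M0)], the exponential gain [exp (- B * T / 4)] beats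
every power of [S] for a suitable [B]; the seventh one is enough. *)
Lemma low_frequency_small (c1 M0 delta lnS S T B lam k m : R) :
  0 < M0 -> 0 < c1 -> 1 <= S -> 1 <= T -> lnS <= c1 / M0 * T -> expR lnS = S ->
  B = 4 * (7 * c1 / M0 + 1) -> 96 / S <= delta -> k = lam * T -> 1 <= lam ->
  lam <= S ^+ 2 -> 1 <= k -> m = k + 1 ->
  4 * S^-1 * Num.sqrt k * (m ^+ 2) * lam^-1 * expR (- (B * T / 4)) <= delta.
Proof.
move=> M00 c10 S1 T1 lS eS BE Sd kE l1 lS2 k1 mE.
have S0 : 0 < S by lra.
apply: le_trans Sd.
have T3 : T ^+ 3 * expR (- T) <= 6.
  rewrite expRN ler_pdivrMr ?expR_gt0//.
  have := @expR_ge_exprn _ T 3 (le_trans ler01 T1).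
  by rewrite (_ : 3`! = 6)%N// ler_pdivrMr// mulrC.
have S7 : S ^+ 7 * expR (- (7 * c1 / M0 * T)) <= 1.
  have -> : 7 * c1 / M0 * T = 7 * (c1 / M0 * T) by ring.
  by rewrite -eS -expRM_natr -expRD -[leRHS]expR0 ler_expR; lra.
have -> : expR (- (B * T / 4)) = expR (- (7 * c1 / M0 * T)) * expR (- T).
  by rewrite -expRD BE; congr expR; field; rewrite gt_eqF.
set e1 := expR (- (7 * c1 / M0 * T)) in S7 *; set e2 := expR (- T) in T3 *.
have e10 : 0 <= e1 by exact: expR_ge0.
have e20 : 0 <= e2 by exact: expR_ge0.
have sk : Num.sqrt k <= k.
  have k0 : 0 <= k by lra.
  rewrite -(@ler_pXn2r _ 2)// ?nnegrE ?sqrtr_ge0// sqr_sqrtr// expr2.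
  by rewrite ler_peMr.
have kS : k <= S ^+ 2 * T by rewrite kE ler_wpM2r//; lra.
have m2 : m ^+ 2 <= 4 * k ^+ 2 by rewrite mE; nra.
have li : lam^-1 <= 1 by rewrite invf_le1//; lra.
have l0 : 0 <= lam^-1 by rewrite invr_ge0; lra.
have k0 : 0 <= k by lra.
have Si : 0 <= S^-1 by rewrite invr_ge0 ltW.
apply: (@le_trans _ _ (4 * S^-1 * k * (4 * k ^+ 2) * 1 * (e1 * e2))).
  apply: ler_wpM2r; first exact: mulr_ge0.
  have n1 : 0 <= 4 * S^-1 by rewrite mulr_ge0.
  have n2 : 0 <= 4 * S^-1 * Num.sqrt k by rewrite mulr_ge0// sqrtr_ge0.
  have h1 : 4 * S^-1 * Num.sqrt k * m ^+ 2 <= 4 * S^-1 * k * (4 * k ^+ 2).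
    by apply: ler_pM => //; [exact: sqr_ge0|exact: ler_wpM2l].
  by apply: ler_pM => //; apply: mulr_ge0 => //; exact: sqr_ge0.
rewrite [leLHS](_ : _ = 16 * S^-1 * (k ^+ 3 * (e1 * e2))); last by ring.
apply: (@le_trans _ _ (16 * S^-1 * ((S ^+ 2 * T) ^+ 3 * (e1 * e2)))).
  rewrite ler_wpM2l ?mulr_ge0// ler_wpM2r ?mulr_ge0//.
  by apply: lerXn2r; rewrite ?nnegrE ?mulr_ge0 ?sqr_ge0//; lra.
have S6 : S ^+ 6 * e1 <= 1.
  apply: le_trans S7; rewrite ler_wpM2r//.
  by apply: ler_weXn2l.
rewrite [leLHS](_ : _ = 16 * S^-1 * ((S ^+ 6 * e1) * (T ^+ 3 * e2))); last by ring.
rewrite [leRHS](_ : _ = 16 * S^-1 * (1 * 6)); last by ring.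
have T0 : 0 <= T by lra.
by rewrite ler_wpM2l ?mulr_ge0// ler_pM ?mulr_ge0 ?exprn_ge0 ?(ltW S0).
Qed.

(** The exponent is where [1 / c1 < 1 - 1 / (2 * beta)] enters: the gain [1 / S]
in the width of the pulse absorbs the factor [S] of [S * Kv], and [Mv] costs
[Kv ^ (1 / beta)] at most. *)
Lemma high_frequency_small (theta beta c1 delta A Mv Kv S T L q : R) :
  0 < c1 -> 0 < beta -> 0 < delta -> 1 <= S -> 1 <= Kv -> 0 < Mv -> 0 < A ->
  L = ln S + ln Kv -> ln Mv <= ln Kv / beta -> T = Mv * L / c1 ->
  0 < 1 - theta - (2 * beta)^-1 ->
  256 * A / (c1 * (1 - theta - (2 * beta)^-1) ^+ 2 * delta ^+ 2) <= L -> 0 < L ->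
  0 <= q -> q ^+ 2 <= 2 * A * T / S ^+ 2 ->
  16 * q * expR (theta * L) <= delta * Kv.
Proof.
move=> c10 b0 d0 S1 K1 M0 A0 LE lM TE g0 YL L0 q0 qA.
set g := 1 - theta - _ in g0 YL.
have S0 : 0 < S by lra.
have K0 : 0 < Kv by lra.
have lnS0 : 0 <= ln S by rewrite ln_ge0.
have lnK0 : 0 <= ln Kv by rewrite ln_ge0.
rewrite -(@ler_pXn2r _ 2)// ?nnegrE ?mulr_ge0 ?expR_ge0 ?(ltW d0) ?(ltW K0)//.
rewrite [leLHS](_ : _ = q ^+ 2 * (256 * expR (theta * L) ^+ 2)); last by ring.
have h0 : 0 <= 256 * expR (theta * L) ^+ 2.
  by apply: mulr_ge0; [exact: ler0n|exact: sqr_ge0].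
apply: (le_trans (ler_wpM2r h0 qA)).
have Mle : Mv <= expR (ln Kv / beta) by rewrite -ler_ln ?posrE ?expR_gt0// expRK.
have SE : S ^+ 2 = expR (ln S * 2) by rewrite expRM_natr lnK// posrE.
have KE : Kv ^+ 2 = expR (ln Kv * 2) by rewrite expRM_natr lnK// posrE.
have main : Mv * expR (theta * L) ^+ 2 <= S ^+ 2 * Kv ^+ 2 * expR (- (2 * g * L)).
  apply: (@le_trans _ _ (expR (ln Kv / beta) * expR (theta * L) ^+ 2)).
    by rewrite ler_wpM2r// sqr_ge0.
  rewrite SE KE -!expRM_natr -!expRD ler_expR.
  have : ln Kv / beta <= L / beta by rewrite ler_wpM2r ?invr_ge0 ?(ltW b0)// LE lerDr.
  have -> : - (2 * g * L) = - (2 * L) + 2 * theta * L + L / beta.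
    by rewrite /g; field; rewrite gt_eqF.
  by rewrite LE; lra.
rewrite TE [leLHS](_ : _ = (512 * A / c1 * L / S ^+ 2) * (Mv * expR (theta * L) ^+ 2)); last first.
  by field; rewrite !gt_eqF.
have h1 : 0 <= 512 * A / c1 * L / S ^+ 2.
  apply: divr_ge0; last exact: sqr_ge0.
  apply: mulr_ge0; last exact: ltW.
  apply: divr_ge0; last exact: ltW.
  by apply: mulr_ge0; [exact: ler0n|exact: ltW].
apply: (le_trans (ler_wpM2l h1 main)).
rewrite [leLHS](_ : _ = Kv ^+ 2 * (512 * A / c1 * L * expR (- (2 * g * L)))); last first.
  by field; rewrite !gt_eqF.
rewrite exprMn mulrC ler_wpM2r ?sqr_ge0//.
rewrite expRN ler_pdivrMr ?expR_gt0//.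
have y0 : 0 <= 2 * g * L by rewrite !mulr_ge0 ?(ltW g0) ?(ltW L0).
have := le_sqr_expR y0 => h2.
have d20 : 0 <= delta ^+ 2 by rewrite sqr_ge0.
apply: le_trans (ler_wpM2l d20 h2).
move: YL; rewrite ler_pdivrMr ?mulr_gt0 ?exprn_gt0// => YL.
rewrite [leRHS](_ : _ = 2 / c1 * L * (L * (c1 * g ^+ 2 * delta ^+ 2))); last first.
  by field; rewrite gt_eqF.
rewrite [leLHS](_ : _ = 2 / c1 * L * (256 * A)); last by field; rewrite gt_eqF.
by rewrite ler_wpM2l// mulr_ge0 ?divr_ge0 ?(ltW c10) ?(ltW L0).
Qed.

(** The order [k] is chosen so that [k / T] is about [S ^ 2 / A]: small enough for
the gain at low frequencies, and large enough for the width [T / sqrt k] of the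
pulse to be about [sqrt T / S]. *)
Lemma good_pulse_of_large (M0 c1 beta eta delta theta eps A B S Mv Kv : R) :
  0 < M0 -> 0 < c1 -> 0 < beta -> 0 < eta -> 0 < delta ->
  (1 + eps) / c1 = theta -> 0 < eps -> 0 < 1 - theta - (2 * beta)^-1 ->
  B = 4 * (7 * c1 / M0 + 1) -> 4 <= B -> A = B + 2 * eta ->
  4 <= S -> expR (c1 / M0) <= S -> M0^-1 <= S -> 648 / delta <= S ->
  expR (256 * A / (c1 * (1 - theta - (2 * beta)^-1) ^+ 2 * delta ^+ 2)) <= S ->
  2 * A <= S -> 4 <= S ^+ 2 / A / 2 -> eta + 1 <= S ^+ 2 / A / 2 ->
  2 * c1 / M0 <= S ^+ 2 / A / 2 -> B <= S ^+ 2 / A / 2 -> M0^-1 < S ^+ 2 / A / 2 ->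
  (1 + (1 + eps) / M0) / eps <= S ^+ 2 / A / 2 ->
  M0 <= Mv -> 1 <= Kv -> ln Mv <= ln Kv / beta ->
  exists T k, good_pulse M0 c1 eta delta Mv Kv S T k.
Proof.
move=> M00 c10 b0 eta0 d0 thetaE eps0 g0 BE B4 AE S4 Sc SM Sd SY SA
  l4 leta lrate lB lM leps MM K1 lMK.
have S0 : 0 < S by apply: lt_le_trans S4.
have S1 : 1 <= S by apply: le_trans S4; rewrite ler1n.
have K0 : 0 < Kv by apply: lt_le_trans K1.
have Mv0 : 0 < Mv by apply: lt_le_trans MM.
have cM0 : 0 < c1 / M0 by rewrite divr_gt0.
have A4 : 4 <= A by rewrite AE (le_trans B4)// lerDl mulr_ge0// ltW.
have A0 : 0 < A by apply: lt_le_trans A4.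
have lnc : c1 / M0 <= ln S by rewrite -ler_expR lnK ?posrE.
have lnY := SY; rewrite -[leRHS]lnK ?posrE// ler_expR in lnY.
have lnK0 : 0 <= ln Kv by rewrite ln_ge0.
pose L := ln S + ln Kv.
have LE : ln (S * Kv) = L by rewrite lnM ?posrE.
have LS : ln S <= L by rewrite /L lerDl.
have L0 : 0 < L by apply: lt_le_trans LS; apply: lt_le_trans lnc.
pose T := Mv * L / c1.
have MvT : Mv * L = c1 * T by rewrite /T [RHS]mulrC divfK// gt_eqF.
have lnT : ln S <= c1 / M0 * T.
  rewrite /T [leRHS](_ : _ = Mv / M0 * L); last by field; rewrite !gt_eqF.
  apply: (le_trans LS); rewrite ler_peMl ?(ltW L0)//.
  by rewrite ler_pdivlMr// mul1r.
have T1 : 1 <= T.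
  by rewrite -(@ler_pM2l _ (c1 / M0))// mulr1; apply: le_trans lnT.
have T0 : 0 < T by apply: lt_le_trans T1.
pose w := S ^+ 2 * T / A.
have S20 : 0 <= S ^+ 2 / A by rewrite divr_ge0 ?sqr_ge0// ltW.
have w8 : S ^+ 2 / A <= w by rewrite /w [leRHS]mulrAC ler_peMr.
have w0 : 0 <= w by apply: le_trans w8.
pose k := Num.truncn w.
have /andP[kw wk] : k%:R <= w < k.+1%:R by exact: truncn_itv.
have half (u v a : R) : 4 <= v / 2 -> v <= u -> u < a + 1 -> u / 2 <= a /\ 4 <= a.
  by clear; lra.
have [k2 k4] : w / 2 <= k%:R /\ 4 <= k%:R :> R.
  by apply: half l4 w8 _; rewrite natr1.
have k1 : (1 < k)%N by rewrite -(ltr_nat R) (lt_le_trans _ k4)// ltr_nat.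
have k0 : (0 < k)%N by apply: ltn_trans k1.
have k0R : 0 < k%:R :> R by rewrite ltr0n.
pose lam := k%:R / T.
have kE : k%:R = lam * T by rewrite /lam divfK// gt_eqF.
have lamA : A * lam <= S ^+ 2.
  by rewrite mulrC -ler_pdivlMr// /lam ler_pdivrMr// mulrAC.
have lam2 : S ^+ 2 / A / 2 <= lam.
  by rewrite /lam ler_pdivlMr//; apply: le_trans k2; rewrite mulrAC [X in X / 2 <= _]mulrAC.
have lam4 := le_trans l4 lam2; have lameta := le_trans leta lam2.
have lamrate := le_trans lrate lam2; have lamB := le_trans lB lam2.
have lamM := lt_le_trans lM lam2; have lameps := le_trans leps lam2.
have lam0 : 0 < lam by apply: lt_le_trans lam4.
have lam1 : 1 <= lam by apply: le_trans lam4; rewrite ler1n.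
have lamS : lam <= S ^+ 2.
  by apply: le_trans lamA; rewrite ler_peMl ?(ltW lam0)// (le_trans _ A4)// ler1n.
have lamk : lam <= k%:R by rewrite kE ler_peMr// ltW.
have coef := pulse_coef_le S0 T0 k0.
have coef0 := pulse_coef_ge0 k S0 T0.
have k1R : 1 <= k%:R :> R by rewrite ler1n.
have lamK : lam ^+ k * lam^-1 ^+ k.+1 = lam^-1.
  by rewrite exprSr mulrA -exprMn mulfV ?gt_eqF// expr1n mul1r.
have T0' := ltW T0; have S0' := ltW S0; have eta0' := ltW eta0.
have sk0 : 0 <= Num.sqrt k%:R :> R by rewrite sqrtr_ge0.
have Si0 : 0 <= S^-1 by rewrite invr_ge0.
exists T, k; split => //.
- apply: le_trans k2; rewrite /w.
  rewrite [leRHS](_ : _ = S * (S / A / 2 * T)); last by ring.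
  rewrite ler_peMr//; apply: (@le_trans _ _ (S / A / 2)); last first.
    by rewrite ler_peMr// !divr_ge0// ltW.
  by rewrite ler_pdivlMr// mul1r ler_pdivlMr.
- apply: le_trans lamA; rewrite ler_wpM2r ?(ltW lam0)//.
  by apply: le_trans A4; rewrite ler_nat.
- by rewrite LE.
- apply: (le_trans expR1_le4); apply: (le_trans S4).
  by rewrite ler_peMr.
- by rewrite ler_pdivrMr// mulrC -ler_pdivrMr.
- move=> z zS zeta.
  have Bn : 0 <= B by apply: le_trans B4.
  have etal : eta <= lam by apply: le_trans lameta; rewrite lerDl.
  have BS : (B + 2 * eta) * lam <= S ^+ 2 by rewrite -AE.
  have low := pole_low_frequency T0 k0 eta0' etal Bn lamB S0' BS zS zeta.
  apply: (@le_trans _ _ (4 * S^-1 * Num.sqrt k%:R * lam ^+ k * k.+1%:R ^+ 2 *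
      (lam^-1 ^+ k.+1 * expR (- (B * T / 4))))).
    apply: ler_pM => //.
    - by apply: mulr_ge0 => //; exact: sqr_ge0.
    - by apply: exprn_ge0; rewrite invr_ge0 cabs_ge0.
    - by apply: ler_wpM2r => //; exact: sqr_ge0.
  have -> : 4 * S^-1 * Num.sqrt k%:R * lam ^+ k * k.+1%:R ^+ 2 *
      (lam^-1 ^+ k.+1 * expR (- (B * T / 4))) =
    4 * S^-1 * Num.sqrt k%:R * (k.+1%:R ^+ 2) * lam^-1 * expR (- (B * T / 4)).
    rewrite -[in RHS]lamK; move: (lam ^+ k) (lam^-1 ^+ k.+1) (4 * _) (expR _) => a b c d.
    by ring.
  have S96 : 96 / S <= delta.
    apply: (@le_trans _ _ (648 / S)); last by rewrite ler_pdivrMr// mulrC -ler_pdivrMr.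
    by rewrite ler_wpM2r// ler_nat.
  apply: (@low_frequency_small c1 M0 delta (ln S) S T B lam k%:R k.+1%:R) => //.
  + by rewrite lnK// posrE.

  + by rewrite natr1.
- move=> z zx z0.
  have Mi0 : 0 <= Mv^-1 by rewrite invr_ge0 ltW.
  have MiM : Mv^-1 <= M0^-1 by rewrite lef_pV2 ?posrE.
  have Mil : Mv^-1 < lam by apply: le_lt_trans lamM.
  have MiS : Mv^-1 <= S by apply: le_trans SM.
  have lS : lam ^+ 2 <= S ^+ 2 * k%:R.
    by rewrite expr2; apply: ler_pM => //; exact: ltW.
  have high := pole_high_frequency T0 k0 S0 Mi0 Mil MiS lS zx z0.
  set rho := k%:R / T - Mv^-1 in high.
  have rho0 : 0 < rho by rewrite /rho subr_gt0.
  have c4 : 0 <= 4 * S * rho^-1 ^+ k.+1.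
    by apply: mulr_ge0; [exact: mulr_ge0|apply: exprn_ge0; rewrite invr_ge0 ltW].
  rewrite mulrCA; apply: (le_trans (ler_wpM2l coef0 high)).
  apply: (le_trans (ler_wpM2r c4 coef)).
  rewrite -/lam [leLHS](_ : _ = 16 * (Num.sqrt k%:R / lam) * (lam / rho) ^+ k.+1); last first.
    have -> : (lam / rho) ^+ k.+1 = lam * (lam ^+ k * rho^-1 ^+ k.+1).
      by rewrite exprMn exprS mulrA.
    move: (lam ^+ k) (rho^-1 ^+ k.+1) (Num.sqrt _) => a b c.
    by field; rewrite !gt_eqF.
  (* [k.+1 * Mv^-1 / rho] exceeds [T / Mv = L / c1] by a factor at most [1 + eps] *)
  have decay : (lam / rho) ^+ k.+1 <= expR (theta * L).
    have -> : lam / rho = 1 + Mv^-1 / rho.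
      by rewrite -{1}[lam](subrK Mv^-1) -/rho mulrDl divff ?gt_eqF.
    have e0 : 0 <= Mv^-1 / rho by rewrite divr_ge0// ltW.
    apply: (@le_trans _ _ (expR (Mv^-1 / rho) ^+ k.+1)).
      by apply: lerXn2r; rewrite ?nnegrE ?expR_ge0 ?expR_ge1Dx ?addr_ge0.
    rewrite -expRM_natr ler_expR.
    have -> : theta * L = Mv^-1 * ((1 + eps) * T).
      by rewrite -thetaE /T; field; rewrite !gt_eqF.
    rewrite -mulrA ler_wpM2l// mulrC ler_pdivrMr// -natr1 kE.
    have h1 : 1 + (1 + eps) / M0 <= eps * lam by rewrite [leRHS]mulrC -ler_pdivrMr.
    have h2 : (1 + eps) * T * Mv^-1 <= (1 + eps) * T * M0^-1.
      by rewrite ler_wpM2l// mulr_ge0// addr_ge0// ltW.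
    have h3 : 1 + (1 + eps) * T * M0^-1 <= T * (eps * lam).
      apply: le_trans (ler_wpM2l T0' h1).
      have -> : T * (1 + (1 + eps) / M0) = T + (1 + eps) * T * M0^-1 by ring.
      by rewrite lerD2r.
    rewrite /rho -/lam mulrBr [X in _ <= X - _](_ : _ = lam * T + T * (eps * lam)); last by ring.
    by move: h2 h3; clear; move: (lam * T) (T * (eps * lam)) (_ * M0^-1) (_ * Mv^-1) => a b c d; lra.
  have q0 : 0 <= Num.sqrt k%:R / lam by rewrite divr_ge0// ltW.
  apply: (@le_trans _ _ (16 * (Num.sqrt k%:R / lam) * expR (theta * L))).
    by apply: ler_wpM2l => //; apply: mulr_ge0.
  have qA : (Num.sqrt k%:R / lam) ^+ 2 <= 2 * A * T / S ^+ 2.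
    rewrite exprMn sqr_sqrtr ?ler0n// kE.
    rewrite [leLHS](_ : _ = T / lam); last by field; rewrite gt_eqF.
    rewrite ler_pdivrMr// [leRHS](_ : _ = T * (2 * A * lam / S ^+ 2)); last by ring.
    rewrite ler_peMr// ler_pdivlMr ?exprn_gt0// mul1r.
    by move: lam2; rewrite ler_pdivrMr// ler_pdivrMr//; set u := S ^+ 2; move=> h; apply: (le_trans h); rewrite le_eqVlt; apply/orP; left; apply/eqP; ring.
  apply: (high_frequency_small c10 b0 d0 S1 K1 Mv0 A0 (erefl L) lMK (erefl T) g0) => //.
  exact: le_trans lnY LS.
Qed.

(** The strict inequality between [c1^-1] and [1 - (2 * beta)^-1] leaves room for
an exponent [theta] between them; [eps] is the relative room above [c1^-1]. *)
Lemma exists_good_pulse (M0 c1 beta eta delta : R) :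
  0 < M0 -> 0 < c1 -> 0 < beta -> c1^-1 < 1 - (2 * beta)^-1 -> 0 < eta ->
  0 < delta ->
  exists X, forall S Mv Kv, X <= S -> M0 <= Mv -> 1 <= Kv ->
    ln Mv <= ln Kv / beta ->
    exists T k, good_pulse M0 c1 eta delta Mv Kv S T k.
Proof.
move=> M00 c10 b0 cb eta0 d0.
pose theta := (c1^-1 + (1 - (2 * beta)^-1)) / 2.
have g0 : 0 < 1 - theta - (2 * beta)^-1 by rewrite /theta; lra.
pose eps := theta * c1 - 1.
have eps0 : 0 < eps.
  have : c1^-1 < theta by rewrite /theta; lra.
  by rewrite -(ltr_pM2r c10) mulVf ?gt_eqF// /eps subr_gt0.
have thetaE : (1 + eps) / c1 = theta by rewrite /eps addrC subrK mulfK// gt_eqF.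
pose B := 4 * (7 * c1 / M0 + 1).
have B4 : 4 <= B.
  by rewrite /B ler_peMr// lerDr divr_ge0 ?(ltW M00)// mulr_ge0// ltW.
pose A := B + 2 * eta.
have A0 : 0 < A by rewrite /A ltr_wpDr ?(lt_le_trans _ B4)// mulr_ge0// ltW.
pose Lam := Num.max 4 (Num.max (eta + 1) (Num.max (2 * c1 / M0) (Num.max B
  (Num.max (M0^-1 + 1) ((1 + (1 + eps) / M0) / eps))))).
exists (Num.max 4 (Num.max (expR (c1 / M0)) (Num.max M0^-1 (Num.max (648 / delta)
  (Num.max (expR (256 * A / (c1 * (1 - theta - (2 * beta)^-1) ^+ 2 * delta ^+ 2)))
  (Num.max (2 * A) (2 * A * Lam))))))).
move=> S Mv Kv.
rewrite 6!ge_max.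
move=> /andP[S4 /andP[Sc /andP[SM /andP[Sd /andP[SY /andP[SA SL]]]]]].
have : Lam <= S ^+ 2 / A / 2.
  rewrite -mulrA -invfM ler_pdivlMr ?mulr_gt0// mulrC (mulrC A).
  have S1 : 1 <= S by apply: le_trans S4; rewrite ler1n.
  by apply: (le_trans SL); rewrite expr2 ler_peMr// (le_trans ler01).
rewrite 5!ge_max.
move=> /andP[l4 /andP[leta /andP[lrate /andP[lB /andP[lM leps]]]]].
have lM' : M0^-1 < S ^+ 2 / A / 2 by apply: lt_le_trans lM; rewrite ltrDl.
exact: (@good_pulse_of_large M0 c1 beta eta delta theta eps A B S Mv Kv).
Qed.

End ParameterChoice.

(** * Complex pulses and their transforms *)

Section ComplexPulse.
Context {R : realType}.
Implicit Types (S T t : R) (k : nat) (z : R[i]).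

Lemma complex_ext (x y : R[i]) : complex.Re x = complex.Re y ->
  complex.Im x = complex.Im y -> x = y.
Proof. by case: x => a b; case: y => c d /= -> ->. Qed.

Definition cpulse S T k t : R[i] := pulse S T k 0 t +i* pulse S T k (pi / 2) t.

Lemma cos_sub_pihalf (x : R) : cos (x - pi / 2) = sin x.
Proof. by rewrite cosB cos_pihalf sin_pihalf mulr0 add0r mulr1. Qed.

Lemma cpulseE S T k t :
  cpulse S T k t = (S^-1 * peak (t / T) ^+ k)%:C * cexp (0 +i* (2 * S * t)).
Proof.
rewrite /cpulse /pulse cos_sub_pihalf subr0.
apply: complex_ext.
- by rewrite [RHS]cReM Re_cexp /= expR0 mul0r subr0 mul1r mulrA.
- by rewrite [RHS]cImM Im_cexp /= expR0 mul0r addr0 mul1r mulrA.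
Qed.

Lemma cabs_cpulse S T k t : 0 < S -> 0 < T -> 0 <= t ->
  cabs (cpulse S T k t) = S^-1 * peak (t / T) ^+ k.
Proof.
move=> S0 T0 t0; rewrite cpulseE cabsM cabs_real cabs_cexp /= expR0 mulr1 ger0_norm//.
by rewrite mulr_ge0 ?invr_ge0 ?(ltW S0)// exprn_ge0// peak_ge0// divr_ge0// ltW.
Qed.

Lemma cabs_cpulse_le S T k t : 0 < S -> 0 < T -> 0 <= t ->
  cabs (cpulse S T k t) <= S^-1.
Proof.
move=> S0 T0 t0; rewrite cabs_cpulse//.
have u0 : 0 <= t / T by rewrite divr_ge0 ?(ltW T0).
by rewrite ler_piMr ?invr_ge0 ?(ltW S0)// exprn_ile1 ?peak_le1 ?peak_ge0.
Qed.

Lemma cabs_cpulse_peak S T k : 0 < S -> 0 < T -> cabs (cpulse S T k T) = S^-1.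
Proof.
by move=> S0 T0; rewrite cabs_cpulse ?(ltW T0)// divff ?gt_eqF// peak1 expr1n mulr1.
Qed.

Lemma cexp_cpulseE S T k z t : T != 0 ->
  cexp (- z * t%:C) * cpulse S T k t =
  (S^-1 * (expR 1 / T) ^+ k)%:C *
    ((t ^+ k)%:C * cexp (- ((z + pulse_pole S T k) * t%:C))).
Proof.
move=> T0; rewrite cpulseE.
have -> : S^-1 * peak (t / T) ^+ k =
    S^-1 * (expR 1 / T) ^+ k * t ^+ k * expR (- (k%:R / T * t)).
  rewrite /peak expRD exprMn [(expR _ * expR _) ^+ k]exprMn -[expR (- (t / T)) ^+ k]expRM_natr.
  rewrite (_ : - (t / T) * k%:R = - (k%:R / T * t)); last by ring.
  rewrite !expr_div_n; ring.
have -> : cexp (- ((z + pulse_pole S T k) * t%:C)) =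
    cexp (- z * t%:C) * ((expR (- (k%:R / T * t)))%:C * cexp (0 +i* (2 * S * t))).
  have -> : (expR (- (k%:R / T * t)))%:C * cexp (0 +i* (2 * S * t)) =
      cexp ((- (k%:R / T * t)) +i* (2 * S * t)) :> R[i].
    by rewrite /cexp /= expR0 mul1r.
  rewrite -cexpD; congr cexp; case: z => x y; rewrite /pulse_pole.
  apply/eqP; rewrite eq_complex/=; apply/andP; split; apply/eqP; ring.
by rewrite !rmorphM/=; ring.
Qed.

Lemma CintegralZ (r : R) (f : R -> R[i]) : Cintegrable `[0, +oo[ f ->
  Cintegrable `[0, +oo[ (fun t => r%:C * f t) /\
  Cintegral `[0, +oo[ (fun t => r%:C * f t) = r%:C * Cintegral `[0, +oo[ f.
Proof.
move=> [f1 f2].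
have re t : complex.Re (r%:C * f t) = r * complex.Re (f t).
  by rewrite cReM /= mul0r subr0.
have im t : complex.Im (r%:C * f t) = r * complex.Im (f t).
  by rewrite cImM /= mul0r addr0.
split; first split.
- under [X in EFin \o X]eq_fun do rewrite re.
  by apply: eq_integrable (integrableZl _ r f1) => //; exact: measurable_itv.
- under [X in EFin \o X]eq_fun do rewrite im.
  by apply: eq_integrable (integrableZl _ r f2) => //; exact: measurable_itv.
rewrite /Cintegral; under eq_Rintegral do rewrite re.
under [X in _ +i* X]eq_Rintegral do rewrite im.
rewrite !RintegralZl//.
by apply/eqP; rewrite eq_complex/= !mul0r subr0 addr0 !eqxx.
Qed.

Lemma laplace_cpulse S T k z : T != 0 -> - (k%:R / T) < complex.Re z ->
  Cintegrable `[0, +oo[ (fun t : R => cexp (- z * t%:C) * cpulse S T k t) /\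
  Cintegral `[0, +oo[ (fun t : R => cexp (- z * t%:C) * cpulse S T k t) =
    (pulse_coef S T k)%:C * (z + pulse_pole S T k)^-1 ^+ k.+1.
Proof.
move=> T0 zl.
rewrite (_ : (fun t => _) = fun t => (S^-1 * (expR 1 / T) ^+ k)%:C *
    ((t ^+ k)%:C * cexp (- ((z + pulse_pole S T k) * t%:C)))); last first.
  by apply/funext => t; exact: cexp_cpulseE.
have w0 : 0 < complex.Re (z + pulse_pole S T k).
  by move: zl; case: (z) => x y /=; rewrite -subr_gt0 opprK.
have [i1 e1] := laplace_pow k w0.
have [i2 e2] := CintegralZ (S^-1 * (expR 1 / T) ^+ k) i1.
split => //; rewrite e2 e1 /pulse_coef [in RHS]rmorphM rmorph_nat exprVn.
by rewrite -mulrA.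
Qed.

End ComplexPulse.

(** * Superposition of sparse pulses *)

Section PulseContinuity.
Context {R : realType}.

Lemma continuous_pulse' (S T : R) k psi : continuous (pulse' S T k psi).
Proof.
have cM (f g : R -> R) : continuous f -> continuous g -> continuous (fun t => f t * g t).
  by move=> cf cg t; apply: cvgM; [exact: cf|exact: cg].
have cB (f g : R -> R) : continuous f -> continuous g -> continuous (fun t => f t - g t).
  by move=> cf cg t; apply: cvgB; [exact: cf|exact: cg].
have cc (c : R) : continuous (fun _ : R => c) by move=> t; exact: cvg_cst.
have cid : continuous (fun t : R => t) by move=> t; exact: cvg_id.
have caff : continuous (fun t : R => 1 - t / T).
  exact: (cB _ _ (cc 1) (cM _ _ cid (cc T^-1))).
have cph : continuous (fun t : R => 2 * S * t - psi).
  exact: (cB _ _ (cM _ _ (cc (2 * S)) cid) (cc psi)).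
have comp (f g : R -> R) : continuous f -> continuous g -> continuous (fun t => g (f t)).
  by move=> cf cg t; apply: continuous_comp; [exact: cf|exact: cg].
have cpk n : continuous (fun t : R => peak (t / T) ^+ n).
  exact: derive_continuous (fun t => is_derive_peakX T n t).
have cE : continuous (fun t : R => expR (1 - t / T)).
  by apply: (comp _ expR caff); exact: continuous_expR.
have ccos : continuous (fun t : R => cos (2 * S * t - psi)).
  by apply: (comp _ cos cph); exact: continuous_cos.
have csin : continuous (fun t : R => sin (2 * S * t - psi)).
  by apply: (comp _ sin cph); exact: continuous_sin.
exact: (cM _ _ (cc _) (cB _ _
  (cM _ _ (cM _ _ (cM _ _ (cM _ _ (cc _) caff) cE) (cpk k.-1)) ccos)
  (cM _ _ (cpk k) (cM _ _ (cc _) csin)))).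
Qed.

Lemma ccontinuous_of_lipschitz (f : R -> R[i]^o) (B : R) :
  (forall s t, cabs (f s - f t) <= B * `|s - t|) -> continuous f.
Proof.
move=> fB t; apply/cvgrPdist_le => e e0.
have eE : e = (complex.Re e)%:C.
  by have /ger0_Im := ltW e0; case: (e) => a b /= ->.
have re0 : 0 < complex.Re e by rewrite -ltcR -eE.
have B1 : 0 < `|B| + 1 by rewrite ltr_wpDl.
exists (complex.Re e / (`|B| + 1)) => /=; first by rewrite divr_gt0.
move=> s /= ts; rewrite cabs_normE eE lecR; apply: (le_trans (fB _ _)).
rewrite ltr_pdivlMr// in ts; apply: le_trans (ltW ts).
by rewrite mulrC ler_wpM2l// (le_trans (ler_norm B))// lerDl.
Qed.

End PulseContinuity.

Section SparsePulses.
Context {R : realType}.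
Variables (K M : R -> R) (M0 c1 eta : R) (S T : R^nat) (k : nat -> nat).
Let delta n : R := 2^-1 ^+ n.+1.
Hypothesis M0_gt0 : 0 < M0.
Hypothesis c1_gt0 : 0 < c1.
Hypothesis eta_gt0 : 0 < eta.
Hypothesis gp : forall n,
  good_pulse M0 c1 eta (delta n) (M (S n)) (K (S n)) (S n) (T n) (k n).
Hypothesis S8 : 8 <= S 0%N.
Hypothesis S12 : forall n, 12 * S n <= S n.+1.
Hypothesis T12 : forall n, 12 * T n <= T n.+1.

Let S4 n : 4 <= S n. Proof. exact: gp_S (gp n). Qed.
Let T1 n : 1 <= T n. Proof. exact: gp_T (gp n). Qed.
Let S_gt0 n : 0 < S n. Proof. by apply: lt_le_trans (S4 n). Qed.
Let T_gt0 n : 0 < T n. Proof. by apply: lt_le_trans (T1 n). Qed.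
Let T_neq0 n : T n != 0. Proof. by rewrite gt_eqF. Qed.
Let S1 n : 1 <= S n.
Proof. by apply: le_trans (S4 n); rewrite ler1n. Qed.

Let delta_gt0 n : 0 < delta n.
Proof. by rewrite /delta exprn_gt0. Qed.

Let sum_delta N : series delta N <= 1.
Proof.
suff -> : series delta N = 1 - 2^-1 ^+ N by rewrite gerBl exprn_ge0.
rewrite /series/=; elim: N => [|N IH]; first by rewrite big_nil expr0 subrr.
by rewrite big_nat_recr//= IH /delta exprS; lra.
Qed.

Let sum_invS m p : \sum_(0 <= i < p) (S (m + i)%N)^-1 <= 2 / S m.
Proof.
elim: p m => [|p IH] m; first by rewrite big_geq// divr_ge0// ltW.
rewrite big_nat_recl//= addn0.
have -> : \sum_(0 <= i < p) (S (m + i.+1)%N)^-1 = \sum_(0 <= i < p) (S (m.+1 + i)%N)^-1.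
  by apply: eq_bigr => i _; rewrite addSnnS.
apply: (le_trans (lerD (lexx _) (IH m.+1))).
have h : (S m.+1)^-1 <= 12^-1 * (S m)^-1.
  by rewrite -invfM lef_pV2 ?posrE ?mulr_gt0.
have : 0 < (S m)^-1 by rewrite invr_gt0.
by move: h; lra.
Qed.

Let sum_invS1 N : series (fun n => (S n)^-1) N <= 1.
Proof.
apply: (le_trans (sum_invS 0 N)); rewrite ler_pdivrMr// mul1r.
by apply: le_trans S8; rewrite ler_nat.
Qed.

Let T_mono m n : (m < n)%N -> 12 * T m <= T n.
Proof.
elim: n => // n IH; rewrite ltnS leq_eqVlt => /predU1P[->//|/IH h].
apply: (le_trans h); apply: le_trans (T12 n).
by rewrite ler_peMl ?(ltW (T_gt0 n))// ler1n.
Qed.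

Let S_ge_nat n : n.+1%:R <= S n.
Proof.
elim: n => [|n IH]; first exact: S1.
apply: le_trans (S12 n); rewrite -natr1.
by have := S1 n; lra.
Qed.

Let T_ge_nat n : n.+1%:R <= T n.
Proof.
elim: n => [|n IH]; first exact: T1.
apply: le_trans (T12 n); rewrite -natr1.
by have := T1 n; lra.
Qed.

(** Two peaks differ by a factor [12] in time, and near a peak means up to a
factor between [1 / 2] and [3 / 2]: so at most one summand is [1]. *)
Let near_peak_sum t N :
  \sum_(0 <= n < N) (if `|t / T n - 1| < 2^-1 then 1 else 0 : R) <= 1.
Proof.
suff [//] : \sum_(0 <= n < N) (if `|t / T n - 1| < 2^-1 then 1 else 0 : R) <= 1 /\
    ((forall n, (n < N)%N -> ~~ (`|t / T n - 1| < 2^-1)) ->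
     \sum_(0 <= n < N) (if `|t / T n - 1| < 2^-1 then 1 else 0 : R) = 0).
elim: N => [|N [IH1 IH2]]; first by rewrite big_nil ler01.
rewrite big_nat_recr//=; case: ifPn => [hN|hN].
  split; last by move=> /(_ N (ltnSn N)); rewrite hN.
  rewrite IH2 ?add0r// => n nN; apply/negP => hn.
  move: hN hn; rewrite !ltr_norml => /andP[h1 _] /andP[_ h2].
  have h3 : t < 2 * T n.
    by rewrite -ltr_pdivrMr//; move: h2; lra.
  have h4 : T N < 2 * t.
    have : 2^-1 < t / T N by move: h1; lra.
    by rewrite ltr_pdivlMr//; lra.
  have := T_mono nN; have := T_gt0 n.
  by move: h3 h4; lra.
rewrite addr0; split => // h; apply: IH2 => n nN; apply: h.
exact: ltnW.
Qed.

Let sum_pulse' psi N t : 0 <= t ->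
  \sum_(0 <= n < N) `|pulse' (S n) (T n) (k n) psi t| <= 15.
Proof.
move=> t0.
apply: (@le_trans _ _ (\sum_(0 <= n < N)
    (14 * (if `|t / T n - 1| < 2^-1 then 1 else 0 : R) + delta n))).
  apply: ler_sum => n _; have g := gp n.
  case: ifPn => [_|]; last rewrite -leNgt => off.
    rewrite mulr1; apply: (@le_trans _ _ 14); last by rewrite lerDl ltW.
    exact: pulse'_bounded (S1 n) (gp_T g) (gp_k g) (gp_rate_le g) t0.
  rewrite mulr0 add0r; apply: le_trans (gp_off g).
  exact: pulse'_off_peak (S1 n) (gp_T g) (gp_k g) (gp_Sk g) t0 off.
rewrite big_split/= -mulr_sumr.
have h1 := near_peak_sum t N; have h2 := sum_delta N.
by apply: (le_trans (lerD (ler_wpM2l (ler0n _ 14) h1) h2)); lra.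
Qed.

Let hp psi n t : 0 <= t -> `|pulse (S n) (T n) (k n) psi t| <= (S n)^-1.
Proof. by move=> t0; apply: pulse_leV. Qed.

Definition pulse_sum (psi : R) : R -> R :=
  hsum (fun n => pulse (S n) (T n) (k n) psi).

Definition pulse_sum' (psi : R) : R -> R :=
  hsum' (fun n => pulse' (S n) (T n) (k n) psi).

Definition cpulse_sum (t : R) : R[i] := pulse_sum 0 t +i* pulse_sum (pi / 2) t.

Definition transform_sum (z : R[i]) : R[i] :=
  csum (fun n => (pulse_coef (S n) (T n) (k n))%:C *
                 (z + pulse_pole (S n) (T n) (k n))^-1 ^+ (k n).+1).

Lemma ccvg_cpulse_sum t : 0 <= t ->
  ccvg (series (fun n => cpulse (S n) (T n) (k n) t)) (cpulse_sum t).
Proof.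
move=> t0; split.
- under eq_fun do rewrite Re_sum.
  exact: (hsum_cvg (hp 0) sum_invS1 t0).
- under eq_fun do rewrite Im_sum.
  exact: (hsum_cvg (hp (pi / 2)) sum_invS1 t0).
Qed.

Let cpulse_sum_lipschitz s t : cabs (cpulse_sum s - cpulse_sum t) <= 30 * `|s - t|.
Proof.
apply: (le_trans (cabs_le_ReIm _)).
have h psi := hsum_lipschitz
  (fun n t => is_derive_pulse (S n) (T n) (k n) psi t)
  (hp psi) sum_invS1 (sum_pulse' psi) s t.
by apply: (le_trans (lerD (h 0) (h (pi / 2)))); lra.
Qed.

Lemma continuous_cpulse_sum : continuous (cpulse_sum : R -> R[i]^o).
Proof. exact: (ccontinuous_of_lipschitz cpulse_sum_lipschitz). Qed.

Lemma locally_integrable_cpulse_sum : locally_integrable0 cpulse_sum.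
Proof.
move=> t t0.
have cs psi : continuous (pulse_sum psi).
  exact: (hsum_continuous (fun n t => is_derive_pulse (S n) (T n) (k n) psi t)
    (hp psi) sum_invS1 (sum_pulse' psi)).
split; apply: continuous_compact_integrable; first exact: segment_compact.
- exact/continuous_subspaceT/cs.
- exact: segment_compact.
- exact/continuous_subspaceT/cs.
Qed.

Lemma bounded_weak_derivative_cpulse_sum : bounded_weak_derivative cpulse_sum.
Proof.
split; first by apply: continuous_subspaceT; exact: continuous_cpulse_sum.
exists (fun t => pulse_sum' 0 t +i* pulse_sum' (pi / 2) t); split.
  split.
    have m psi := measurable_hsum' (fun n => @continuous_pulse' R (S n) (T n) (k n) psi)
      (sum_pulse' psi).
    by split; [exact: (m 0)|exact: (m (pi / 2))].
  exists 30; apply: aeW => t t0; apply: (le_trans (cabs_le_ReIm _)).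
  have h psi := hsum'_le (sum_pulse' psi) (ltW t0).
  by apply: (le_trans (lerD (h 0) (h (pi / 2)))); lra.
move=> phi tphi.
have re (x : R[i]) (y : R) : complex.Re (x * y%:C) = complex.Re x * y.
  by rewrite cReM /= mulr0 subr0.
have im (x : R[i]) (y : R) : complex.Im (x * y%:C) = complex.Im x * y.
  by rewrite cImM /= mulr0 add0r.
have w psi := hsum_weak_derivative
  (fun n t => is_derive_pulse (S n) (T n) (k n) psi t)
  (fun n => @continuous_pulse' R (S n) (T n) (k n) psi)
  (hp psi) sum_invS1 (sum_pulse' psi) tphi.
apply: complex_ext; rewrite [RHS]raddfN.
- transitivity (\int[@lebesgue_measure R]_(t in `]0, +oo[) (pulse_sum 0 t * derive1 phi t)).
    by apply: eq_Rintegral => t _; rewrite re.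
  by rewrite w; congr (- _); apply: eq_Rintegral => t _; rewrite re.
- transitivity (\int[@lebesgue_measure R]_(t in `]0, +oo[)
      (pulse_sum (pi / 2) t * derive1 phi t)).
    by apply: eq_Rintegral => t _; rewrite im.
  by rewrite w; congr (- _); apply: eq_Rintegral => t _; rewrite im.
Qed.

(** At the time of its own peak a pulse dominates the sum: the earlier ones have
decayed below [1 / S n] by the condition on their rates, the later ones have
much smaller amplitudes. *)
Lemma cpulse_sum_peak n : 2^-1 * (S n)^-1 <= cabs (cpulse_sum (T n)).
Proof.
pose u m := cpulse (S m) (T m) (k m) (T n).
have Sn : 0 < (S n)^-1 by rewrite invr_gt0.
have early m : (m < n)%N -> cabs (u m) <= (S m)^-1 * (S n)^-1.
  move=> mn; rewrite /u cabs_cpulse ?(ltW (T_gt0 n))//.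
  rewrite ler_wpM2l ?invr_ge0 ?(ltW (S_gt0 m))//.
  apply: (le_trans (peakX_late _ (T_gt0 m) (T_mono mn))).
  rewrite expRN lef_pV2 ?posrE ?expR_gt0//.
  rewrite -[leLHS]lnK ?posrE// ler_expR.
  apply: (le_trans (gp_lnS (gp n))).
  have h := gp_rate (gp m).
  rewrite [leRHS]mulrAC ler_wpM2r ?(ltW (T_gt0 n))//.
  by rewrite ler_pdivlMr// mulrC mulrA.
have ul N : cabs (\sum_(0 <= m < n) u m + \sum_(0 <= i < N) u (n.+1 + i)%N) <=
    2^-1 * (S n)^-1.
  apply: (le_trans (cabsD _ _)).
  have h1 : cabs (\sum_(0 <= m < n) u m) <= 4^-1 * (S n)^-1.
    apply: (le_trans (cabs_sum _ _ _)).
    apply: (@le_trans _ _ (\sum_(0 <= m < n) (S m)^-1 * (S n)^-1)).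
      by rewrite !big_nat; apply: ler_sum => m /andP[_ mn]; exact: early.
    rewrite -mulr_suml ler_wpM2r ?(ltW Sn)//.
    apply: (le_trans (sum_invS 0 n)); rewrite ler_pdivrMr//.
    by move: S8; lra.
  have h2 : cabs (\sum_(0 <= i < N) u (n.+1 + i)%N) <= 4^-1 * (S n)^-1.
    apply: (le_trans (cabs_sum _ _ _)).
    apply: (@le_trans _ _ (\sum_(0 <= i < N) (S (n.+1 + i)%N)^-1)).
      by apply: ler_sum => i _; apply: cabs_cpulse_le; rewrite ?(ltW (T_gt0 n)).
    apply: (le_trans (sum_invS n.+1 N)); rewrite -invfM ler_pdivrMr//.
    rewrite mulrC ler_pdivlMr ?mulr_gt0//.
    by have := S12 n; have := S_gt0 n; lra.
  by apply: (le_trans (lerD h1 h2)); lra.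
have c := ccvg_cpulse_sum (ltW (T_gt0 n)).
have c' : ccvg (fun N => series u (N + n.+1)%N) (cpulse_sum (T n)).
  by case: c => c1' c2'; split; [move: c1'|move: c2']; rewrite -(cvg_shiftn n.+1).
have cn : ccvg (fun _ => u n) (u n) by split; exact: cvg_cst.
have := ccvg_cabs_le (ccvgB c' cn) (B := 2^-1 * (S n)^-1) => h.
have {}h : cabs (cpulse_sum (T n) - u n) <= 2^-1 * (S n)^-1.
  apply: h => N; apply: le_trans (ul N); rewrite le_eqVlt; apply/orP; left.
  apply/eqP; congr cabs; rewrite /series/=.
  rewrite (@big_cat_nat _ _ _ n)//=; last by rewrite addnS -addSn leq_addl.
  rewrite [X in _ + X - _]big_ltn; last by rewrite addnS ltnS leq_addl.
  have -> : \sum_(n.+1 <= m < N + n.+1) u m = \sum_(0 <= i < N) u (n.+1 + i)%N.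
    rewrite -{1}[n.+1]add0n big_addn addnK.
    by apply: eq_bigr => i _; rewrite addnC.
  by rewrite addrCA addrAC subrr add0r.
have e : cabs (u n) = (S n)^-1 by rewrite /u cabs_cpulse_peak.
have := cabsB (cpulse_sum (T n)) (cpulse_sum (T n) - u n).
rewrite opprB addrCA subrr addr0 e.
by move: h; lra.
Qed.

Let coef_ge0 n : 0 <= pulse_coef (S n) (T n) (k n).
Proof. exact: pulse_coef_ge0. Qed.

Let pole_ge1 n (z : R[i]) : - eta <= complex.Re z ->
  1 <= cabs (z + pulse_pole (S n) (T n) (k n)).
Proof.
move=> zeta; apply: le_trans (Re_le_cabs _); apply: le_trans (ler_norm _).
have := gp_eta (gp n); move: zeta; case: z => x y /=; lra.
Qed.

(** All but finitely many pulses have a scale [S n] above [Y]; the remaining ones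
are accounted for by the constant. *)
Let transform_majorant (Y : R) : exists2 C, 0 <= C &
  forall n (z : R[i]), - eta <= complex.Re z -> `|complex.Im z| <= Y ->
  pulse_coef (S n) (T n) (k n) * (k n).+1%:R ^+ 2 *
    (cabs (z + pulse_pole (S n) (T n) (k n)))^-1 ^+ (k n).+1 <= C * delta n.
Proof.
pose n0 := (Num.truncn `|Y|).+1.
have [C C1 CP] : exists2 C, 1 <= C & forall n, (n < n0)%N ->
    pulse_coef (S n) (T n) (k n) * (k n).+1%:R ^+ 2 <= C * delta n.
  elim: n0 => [|m [C C1 CP]]; first by exists 1.
  pose x := pulse_coef (S m) (T m) (k m) * (k m).+1%:R ^+ 2 / delta m.
  exists (Num.max C x); first by rewrite le_max C1.
  move=> n; rewrite ltnS leq_eqVlt => /predU1P[->|/CP h].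
    by rewrite -ler_pdivrMr// le_max lexx orbT.
  by apply: (le_trans h); rewrite ler_wpM2r ?(ltW (delta_gt0 n))// le_max lexx.
exists C; first by apply: le_trans C1.
move=> n z zeta zY.
have [nn0|n0n] := ltnP n n0.
  apply: le_trans (CP n nn0); rewrite ler_piMr//.
    by rewrite mulr_ge0// exprn_ge0// ler0n.
  rewrite exprn_ile1 ?invr_ge0 ?cabs_ge0// invf_le1 ?pole_ge1//.
  by apply: lt_le_trans (pole_ge1 n zeta).
have zS : `|complex.Im z| <= S n.
  apply: (le_trans zY); apply: le_trans (S_ge_nat n).
  apply: (le_trans (ler_norm Y)); apply: (@le_trans _ _ n0%:R).
    by have /andP[_ /ltW] := truncn_itv (normr_ge0 Y).
  by rewrite ler_nat ltnW.
apply: (le_trans (gp_low (gp n) zS zeta)).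
by rewrite ler_peMl// ltW.
Qed.

Let term_le n (z : R[i]) : cabs ((pulse_coef (S n) (T n) (k n))%:C *
    (z + pulse_pole (S n) (T n) (k n))^-1 ^+ (k n).+1) <=
  pulse_coef (S n) (T n) (k n) * (k n).+1%:R ^+ 2 *
    (cabs (z + pulse_pole (S n) (T n) (k n)))^-1 ^+ (k n).+1.
Proof.
rewrite cabsM cabs_real ger0_norm// cabsX cabsV.
rewrite ler_wpM2r ?exprn_ge0 ?invr_ge0 ?cabs_ge0//.
by rewrite ler_peMr// exprn_ege1// ler1n.
Qed.

Let sum_Cdelta C N : 0 <= C -> series (fun n => C * delta n) N <= C.
Proof.
move=> C0; rewrite /series/= -mulr_sumr ler_piMr//; exact: sum_delta.
Qed.

Lemma ccvg_transform_sum (z : R[i]) : - eta <= complex.Re z ->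
  ccvg (series (fun n => (pulse_coef (S n) (T n) (k n))%:C *
                 (z + pulse_pole (S n) (T n) (k n))^-1 ^+ (k n).+1))
       (transform_sum z).
Proof.
move=> zeta; have [C C0 CP] := transform_majorant `|complex.Im z|.
apply: (@ccvg_csum _ _ (fun n => C * delta n) C) => [n|N]; last exact: sum_Cdelta.
exact: le_trans (term_le n z) (CP n z zeta (lexx _)).
Qed.

Lemma derivable_transform_sum (z : R[i]) : - eta < complex.Re z ->
  derivable (transform_sum : R[i]^o -> R[i]^o) z 1.
Proof.
move=> zeta; pose r := complex.Re z + eta.
have r0 : 0 < r by rewrite /r -ltrBlDr sub0r.
have [C C0 CP] := transform_majorant (`|complex.Im z| + r).
have inhalf h : cabs h < r ->
    - eta <= complex.Re (z + h) /\ `|complex.Im (z + h)| <= `|complex.Im z| + r.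
  move=> hr; split.
    have := le_lt_trans (Re_le_cabs h) hr.
    rewrite ltr_norml /r raddfD/= => /andP[h1 _]; move: h1; lra.
  rewrite raddfD/=; apply: (le_trans (ler_normD _ _)).
  by rewrite lerD2l (le_trans (Im_le_cabs h))// ltW.
apply: (@derivable_csum_inv_pow R _ _ (fun n => (k n).+1) z r (fun n => C * delta n) C) => //.
- by move=> n h /inhalf[h1 _]; exact: pole_ge1.
- by move=> n h /inhalf[h1 h2]; exact: CP.
- by move=> N; exact: sum_Cdelta.
Qed.

Lemma laplace_cpulse_sum (z : R[i]) : 0 < complex.Re z ->
  transform_sum z = laplace cpulse_sum z.
Proof.
move=> z0.
have zl n : - ((k n)%:R / T n) < complex.Re z.
  by apply: le_lt_trans z0; rewrite oppr_le0 divr_ge0// ltW.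
pose u n (t : R) := cexp (- z * t%:C) * cpulse (S n) (T n) (k n) t.
have cz (t : R) : cabs (cexp (- z * t%:C)) = expR (- (complex.Re z * t)).
  by rewrite cabs_cexp; congr expR; case: (z) => x y /=; rewrite mulr0 subr0 mulNr.
have su t N : series (u ^~ t) N =
    cexp (- z * t%:C) * series (fun n => cpulse (S n) (T n) (k n) t) N.
  by rewrite /series/= mulr_sumr.
have h := @ccvg_Cintegral_series R u (fun t => cexp (- z * t%:C) * cpulse_sum t) 1
  (complex.Re z) z0 ler01.
have {}h : ccvg (series (fun n => Cintegral `[0, +oo[ (u n))) (laplace cpulse_sum z).
  apply: h.
  - by move=> n; have [] := laplace_cpulse (S n) (T_neq0 n) (zl n).
  - move=> t t0; rewrite (funext (su t)); apply: ccvgMl; exact: ccvg_cpulse_sum.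
  - move=> N t t0; rewrite su cabsM cz mulrC ler_wpM2r ?expR_ge0//.
    apply: (le_trans (cabs_sum _ _ _)); apply: le_trans (sum_invS1 N).
    by apply: ler_sum => n _; exact: cabs_cpulse_le.
apply: ccvg_unique h.
rewrite (_ : (fun n => Cintegral _ (u n)) = fun n => (pulse_coef (S n) (T n) (k n))%:C *
                 (z + pulse_pole (S n) (T n) (k n))^-1 ^+ (k n).+1).
  by apply: ccvg_transform_sum; apply: le_trans (ltW z0); rewrite oppr_le0 ltW.
by apply/funext => n; have [] := laplace_cpulse (S n) (T_neq0 n) (zl n).
Qed.

(** Below the frequency [S n] the [n]-th transform is small in the whole strip of
width [eta]. Above it the region is no wider than [1 / M (S n)] and the bound
[delta n * K (S n)] is admissible, both by monotonicity. *)
Lemma transform_sum_growth (z : R[i]) :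
  (forall s, 0 <= s -> 0 < K s) -> (forall s, 0 <= s -> 0 < M s) ->
  nondecreasing0 K -> nondecreasing0 M ->
  - eta <= complex.Re z -> Omega M z ->
  cabs (z * transform_sum z) <= (1 + (K 0)^-1) * K `|complex.Im z|.
Proof.
move=> Kpos Mpos Kmono Mmono zeta [zM z0].
set y := `|complex.Im z| in zM *.
have y0 : 0 <= y by exact: normr_ge0.
have K0 := Kpos _ (lexx 0); have Ky := Kpos _ y0.
have K0y : K 0 <= K y by apply: Kmono.
have K1 : 1 <= (K 0)^-1 * K y by rewrite mulrC ler_pdivlMr// mul1r.
apply: (ccvg_cabs_le (ccvgMl z (ccvg_transform_sum zeta))) => N.
rewrite /series/= mulr_sumr; apply: (le_trans (cabs_sum _ _ _)).
have C0 : 0 <= (1 + (K 0)^-1) * K y.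
  by rewrite mulr_ge0 ?addr_ge0 ?invr_ge0 ?(ltW K0) ?(ltW Ky).
apply: le_trans (sum_Cdelta N C0); apply: ler_sum => n _.
have g := gp n; have dn := ltW (delta_gt0 n).
have Sn := S_gt0 n.
have [yS|Sy] := leP y (S n).
  have k1 : 1 <= (k n)%:R :> R by rewrite ler1n (ltn_trans _ (gp_k g)).
  have zk : cabs z <= (k n).+1%:R ^+ 2.
    apply: (le_trans (cabs_le_ReIm _)).
    have zr : `|complex.Re z| <= eta by rewrite ler_norml zeta (le_trans z0)// ltW.
    have ke : eta <= (k n)%:R.
      apply: (@le_trans _ _ ((k n)%:R / T n)).
        by apply: le_trans (gp_eta g); rewrite lerDl.
      by rewrite ler_pdivrMr// ler_peMr.
    have := gp_Sk g; move: yS; rewrite -/y -natr1 => h1 h2.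
    have := sqr_ge0 ((k n)%:R : R).
    rewrite [X in _ -> _ <= X](_ : _ = (k n)%:R ^+ 2 + 2 * (k n)%:R + 1); last by ring.
    by move: zr ke h1 h2 k1; rewrite -/y; lra.
  rewrite cabsM; apply: (@le_trans _ _ (1 * delta n)); last first.
    by rewrite ler_wpM2r// mulrDl mul1r; apply: (le_trans K1); rewrite lerDr ltW.
  rewrite mul1r; apply: le_trans (gp_low g yS zeta).
  rewrite cabsM cabs_real ger0_norm// cabsX cabsV mulrCA -mulrA ler_wpM2l//.
  by rewrite ler_wpM2r ?exprn_ge0 ?invr_ge0 ?cabs_ge0.
have zMS : - (M (S n))^-1 <= complex.Re z.
  apply: le_trans (ltW zM); rewrite lerN2 lef_pV2 ?posrE ?Mpos ?(ltW Sn)//.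
  by apply: Mmono; exact: ltW.
rewrite cabsM (cabsM (_%:C)) cabs_real ger0_norm// cabsX cabsV.
apply: (le_trans (gp_high g zMS z0)).
rewrite mulrC ler_wpM2r//; apply: (@le_trans _ _ (K y)).
  by apply: Kmono; exact: ltW.
by rewrite ler_peMl ?(ltW Ky)// lerDl invr_ge0 ltW.
Qed.

Lemma pulse_times_unbounded (B : R) : exists n, B < T n.
Proof.
exists (Num.truncn `|B|); apply: lt_le_trans (T_ge_nat _).
apply: (le_lt_trans (ler_norm B)).
by have /andP[] := truncn_itv (normr_ge0 B).
Qed.

End SparsePulses.

(** * Consequences of the hypotheses on the two functions *)

Section GrowthFunctions.
Context {R : realType}.
Implicit Types (K M : R -> R).

(** A sequence with a property [P n] at each [n], and with prescribed growth, is
built by recursion when arbitrarily large choices are possible at each step. *)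
Lemma sparse_choice (P : nat -> R -> R -> nat -> Prop) :
  (forall n B, exists S T k, [/\ B <= S, B <= T & P n S T k]) ->
  exists (S T : R^nat) (k : nat -> nat), [/\ forall n, P n (S n) (T n) (k n),
    8 <= S 0%N, forall n, 12 * S n <= S n.+1 & forall n, 12 * T n <= T n.+1].
Proof.
move=> ex.
have /choice[f fP] : forall nB : nat * R, exists x : R * R * nat,
    [/\ nB.2 <= x.1.1, nB.2 <= x.1.2 & P nB.1 x.1.1 x.1.2 x.2].
  by move=> [n B]; have [S [T [k h]]] := ex n B; exists (S, T, k).
pose x := fix x n := if n is m.+1 then f (n, 12 * Num.max (x m).1.1 (x m).1.2)
  else f (0%N, 8).
have xS n : x n.+1 = f (n.+1, 12 * Num.max (x n).1.1 (x n).1.2) by [].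
exists (fun n => (x n).1.1), (fun n => (x n).1.2), (fun n => (x n).2); split.
- by case=> [|n]; [have [] := fP (0%N, 8)|rewrite xS; have [] := fP (n.+1, 12 * Num.max (x n).1.1 (x n).1.2)].
- by have [] := fP (0%N, 8).
- move=> n; rewrite xS; have [h _ _] := fP (n.+1, 12 * Num.max (x n).1.1 (x n).1.2).
  by apply: le_trans h; rewrite ler_wpM2l// le_max lexx.
- move=> n; rewrite xS; have [_ h _] := fP (n.+1, 12 * Num.max (x n).1.1 (x n).1.2).
  by apply: le_trans h; rewrite ler_wpM2l// le_max lexx orbT.
Qed.

Lemma M_log_nondecreasing K M : (forall s, 0 <= s -> 0 < K s) ->
  (forall s, 0 <= s -> 0 < M s) -> nondecreasing0 K -> nondecreasing0 M ->
  nondecreasing0 (M_log M (fun s => s * K s)).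
Proof.
move=> Kpos Mpos Kmono Mmono s t s0 st; have t0 := le_trans s0 st.
have e0 : 0 < expR 1 :> R by exact: expR_gt0.
rewrite /M_log; apply: ler_pM.
- exact/ltW/Mpos.
- by rewrite ln_ge0// le_max -[X in X <= _]expR0 ler_expR ler01.
- exact: Mmono.
rewrite ler_ln ?posrE ?lt_max ?e0//.
rewrite ge_max !le_max lexx /=; apply/orP; right.
by apply: ler_pM => //; [exact/ltW/Kpos|exact: Kmono].
Qed.

Lemma M_log_continuous K M : continuous0 K -> continuous0 M ->
  continuous0 (M_log M (fun s => s * K s)).
Proof.
move=> Kc Mc; apply/subspace_continuousP => s s0.
move/subspace_continuousP : Kc => /(_ s s0) Ks.
move/subspace_continuousP : Mc => /(_ s s0) Ms.
have ids : t @[t --> within [set` `[0%R, +oo[] (nbhs s)] --> s.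
  by apply: cvg_trans (@cvg_id _ (nbhs s)); exact: cvg_within.
apply: (cvgM Ms).
apply: (@cvg_comp _ _ _ (fun t => t * K t) (fun y => ln (Num.max (expR 1) y))
  _ (nbhs (s * K s))); first exact: cvgM.
have m0 : 0 < Num.max (expR 1) (s * K s) by rewrite lt_max expR_gt0.
have cm : Num.max (expR 1) y @[y --> s * K s] --> Num.max (expR 1) (s * K s).
  by apply: (@continuous_max _ _ (fun=> expR 1) id); [exact: cvg_cst|exact: cvg_id].
exact: (cvg_comp _ _ cm (continuous_ln m0)).
Qed.

Lemma M_log_unbounded K M : (forall s, 0 <= s -> 0 < K s) ->
  (forall s, 0 <= s -> 0 < M s) -> nondecreasing0 K -> nondecreasing0 M ->
  forall B, exists2 s, 0 <= s & B <= M_log M (fun s => s * K s) s.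
Proof.
move=> Kpos Mpos Kmono Mmono B.
have K0 := Kpos _ (lexx 0); have M0 := Mpos _ (lexx 0).
pose s := expR (`|B| / M 0) / K 0.
have s0 : 0 < s by rewrite divr_gt0// expR_gt0.
exists s; first exact: ltW.
apply: (le_trans (ler_norm B)); rewrite /M_log.
have -> : `|B| = M 0 * (`|B| / M 0) by rewrite mulrC divfK// gt_eqF.
apply: ler_pM; rewrite ?(ltW M0) ?divr_ge0 ?(ltW M0)//.
  by apply: Mmono => //; exact: ltW.
rewrite -ler_expR lnK ?posrE ?lt_max ?expR_gt0//.
rewrite le_max; apply/orP; right.
have -> : expR (`|B| / M 0) = s * K 0 by rewrite /s divfK// gt_eqF.
by rewrite ler_wpM2l ?(ltW s0)//; apply: Kmono => //; exact: ltW.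
Qed.

Lemma eventually_of_limf_einf (f : R -> R) (Y : R) :
  limf_einf (fun s => (f s)%:E) (+oo%R : set_system R) = +oo%E ->
  exists X, forall s, X < s -> Y <= f s.
Proof.
rewrite limf_einfE => h.
have : (Y%:E < ereal_sup [set ereal_inf [set (f s)%:E | s in A] |
    A in (+oo%R : set_system R)])%E by rewrite h ltry.
move=> /ereal_sup_gt[_ [A [X [_ XA]]] <- YA].
exists X => s /XA As; rewrite -lee_fin; apply: (le_trans (ltW YA)).
by apply: ereal_inf_lbound; exists s.
Qed.

(** For large [s] the factor [s ^ (- alpha)] is at most [1], so the growth
condition bounds [M] by the power [1 / beta] of [K]. *)
Lemma ln_le_of_liminf K M (alpha beta : R) : (forall s, 0 <= s -> 0 < K s) ->
  (forall s, 0 <= s -> 0 < M s) -> nondecreasing0 M -> 0 < alpha -> 0 < beta ->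
  limf_einf (fun s : R => (s `^ (- alpha) * M s `^ (- beta) * K s)%:E)
    (+oo%R : set_system R) = +oo%E ->
  exists X, forall s, X < s -> 1 <= s -> 1 <= K s /\ ln (M s) <= ln (K s) / beta.
Proof.
move=> Kpos Mpos Mmono a0 b0 /eventually_of_limf_einf h.
have M0 := Mpos _ (lexx 0).
have [X XP] := h (Num.max 1 (M 0 `^ (- beta))).
exists X => s /XP; rewrite ge_max => /andP[h1 h2] s1.
have s0 : 0 < s by apply: lt_le_trans s1.
have Ks := Kpos _ (ltW s0); have Ms := Mpos _ (ltW s0).
have MM : M 0 <= M s by apply: Mmono => //; exact: ltW.
have sa : s `^ (- alpha) <= 1.
  rewrite powRN invf_le1 ?powR_gt0// -[leLHS](powRr0 s).
  by apply: ler_powR => //; exact: ltW.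
have le1 : s `^ (- alpha) * M s `^ (- beta) * K s <= M s `^ (- beta) * K s.
  by rewrite ler_wpM2r ?(ltW Ks)// ler_piMl// powR_ge0.
have Mb0 : 0 < M s `^ (- beta) by rewrite powR_gt0.
have Mb : M s `^ (- beta) <= M 0 `^ (- beta).
  rewrite !powRN lef_pV2 ?posrE ?powR_gt0//.
  by apply: ge0_ler_powR => //; rewrite ?nnegrE ltW.
split.
  have := le_trans (le_trans h2 le1) (ler_wpM2r (ltW Ks) Mb).
  by rewrite -{1}[_ `^ _]mulr1 ler_pM2l// powR_gt0.
have h3 := le_trans h1 le1.
rewrite ler_pdivlMr// mulrC -ln_powR ler_ln ?posrE ?powR_gt0//.
by move: h3; rewrite powRN mulrC ler_pdivlMr ?powR_gt0// mul1r.
Qed.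

End GrowthFunctions.

(** * Optimality of the decay rate *)

Lemma closure_Omega_Re {R : realType} (M : R -> R) (z : R[i]^o) :
  (forall s, 0 <= s -> 0 < M s) -> nondecreasing0 M ->
  closure (Omega M : set R[i]^o) z -> - (M 0)^-1 <= complex.Re z.
Proof.
move=> Mpos Mmono cz; rewrite leNgt; apply/negP => zlt.
pose d := - (M 0)^-1 - complex.Re z.
have d0 : 0 < d by rewrite /d subr_gt0.
have [w [[wM _] wz]] : (Omega M : set R[i]^o) `&` ball z d%:C !=set0.
  by apply: cz; apply: nbhsx_ballx; rewrite ltcR.
move: wz; rewrite -ball_normE /= cabs_normE ltcR => zw.
have := le_lt_trans (le_trans (ler_norm _) (Re_le_cabs (w - z))).
rewrite -cabsN opprB => /(_ _ zw).
rewrite raddfB/= /d ltrD2r => h.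
have : - (M 0)^-1 <= - (M `|complex.Im w|)^-1.
  by rewrite lerN2 lef_pV2 ?posrE ?Mpos//; apply: Mmono.
by move=> /le_lt_trans /(_ wM); rewrite ltNge (ltW h).
Qed.

Theorem theorem4p7 (R : realType) (K M : R -> R)
    (Kpos : forall s : R, 0 <= s -> 0 < K s)
    (Mpos : forall s : R, 0 <= s -> 0 < M s)
    (Kcont : continuous0 K) (Mcont : continuous0 M)
    (Kmono : nondecreasing0 K) (Mmono : nondecreasing0 M)
    (hM : exists (N : R -> R) (s0 : R),
       [/\ [/\ continuous0 N, nondecreasing0 N,
               forall s : R, 0 <= s -> 1 <= N s & N 0 = 1],
           0 <= s0 &
           forall s s' : R, s0 <= s -> 0 <= s' -> M (s + s') <= N s' * M s])
    (hMK : positive_increase (fun s : R => M s `^ (- 2^-1) * K s))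
    (alpha beta : R) (alpha_gt0 : 0 < alpha) (beta_gt : 2^-1 < beta)
    (hliminf : limf_einf
       (fun s : R => (s `^ (- alpha) * M s `^ (- beta) * K s)%:E)
       (+oo%R : set_system R) = +oo%E)
    (c1 : R) (hc1 : c_alpha_beta alpha beta < c1) :
  exists (c C : R) (f : R -> R[i]),
    [/\ 0 < c /\ 0 < C,
        locally_integrable0 f /\ bounded_weak_derivative f,
        exists F : R[i]^o -> R[i]^o,
          [/\ laplace_extension f (Omega M) F,
              {within closure (Omega M : set R[i]^o) `|` @Cplus R,
                 continuous F} &
              forall z : R[i], Omega M z -> cabs (z * F z) <= C * K `|complex.Im z|],
        (c%:E <= limf_esup
           (fun t : R =>
              (rcinv (M_log M (fun s : R => s * K s)) (c1 * t) * cabs (f t))%:E)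
           (+oo%R : set_system R))%E &
        exists (eta : R) (G : R[i]^o -> R[i]^o),
          0 < eta /\ laplace_extension f (strip eta) G].
Proof.
have beta0 : 0 < beta by apply: lt_trans beta_gt; rewrite invr_gt0.
have b1 : 0 < 2 * beta - 1 by rewrite subr_gt0 -ltr_pdivrMl// mulr1.
have b2 : 0 < 2 * beta by rewrite mulr_gt0.
have c1b : 2 * beta / (2 * beta - 1) < c1.
  by apply: le_lt_trans hc1; rewrite /c_alpha_beta le_max lexx orbT.
have c10 : 0 < c1 by apply: lt_trans c1b; rewrite divr_gt0.
have c1i : c1^-1 < 1 - (2 * beta)^-1.
  rewrite [ltRHS](_ : _ = (2 * beta / (2 * beta - 1))^-1); last first.
    by field; rewrite !gt_eqF.
  by rewrite ltf_pV2 ?posrE ?divr_gt0.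
have M0 := Mpos _ (lexx 0); have K0 := Kpos _ (lexx 0).
pose eta := (M 0)^-1 + 1.
have eta0 : 0 < eta by rewrite addr_gt0 ?invr_gt0.
have Mieta : (M 0)^-1 < eta by rewrite /eta ltrDl.
have [X0 X0P] := ln_le_of_liminf Kpos Mpos Mmono alpha_gt0 beta0 hliminf.
have [S [T [k [gp S8 S12 T12]]]] : exists (S T : R^nat) (k : nat -> nat),
    [/\ forall n, good_pulse (M 0) c1 eta (2^-1 ^+ n.+1) (M (S n)) (K (S n))
                             (S n) (T n) (k n),
    8 <= S 0%N, forall n, 12 * S n <= S n.+1 & forall n, 12 * T n <= T n.+1].
  apply: (@sparse_choice R (fun n S T k =>
    good_pulse (M 0) c1 eta (2^-1 ^+ n.+1) (M S) (K S) S T k)) => n B.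
  have d0 : 0 < 2^-1 ^+ n.+1 :> R by rewrite exprn_gt0.
  have [X XP] := exists_good_pulse M0 c10 beta0 c1i eta0 d0.
  pose S := Num.max X (Num.max B (Num.max 1 (Num.max (X0 + 1) (expR (c1 / M 0 * B))))).
  have : S <= S by [].
  rewrite {1}/S !ge_max => /and5P[XS BS S1 XS0 ES].
  have S0 : 0 < S by apply: lt_le_trans S1.
  have X0S : X0 < S by apply: lt_le_trans XS0; rewrite ltrDl.
  have [KS lnS] := X0P S X0S S1.
  have MS : M 0 <= M S by apply: Mmono => //; exact: ltW.
  have [T [k g]] := XP S (M S) (K S) XS MS KS lnS.
  exists S, T, k; split => //.
  have cM0 : 0 < c1 / M 0 by rewrite divr_gt0.
  rewrite -(ler_pM2l cM0); apply: le_trans (gp_lnS g).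
  by rewrite -ler_expR lnK.
have T1 n : 1 <= T n := gp_T (gp n).
have T0 n : 0 < T n by apply: lt_le_trans (T1 n).
have S0 n : 0 < S n by apply: lt_le_trans (gp_S (gp n)).
have K1pos := addr_gt0 ltr01 (divr_gt0 ltr01 K0).
pose F := transform_sum S T k.
have dF (z : R[i]) : - eta < complex.Re z -> derivable (F : R[i]^o -> R[i]^o) z 1.
  by move=> zeta; exact: (derivable_transform_sum gp S12 zeta).
have Fl (z : R[i]) : 0 < complex.Re z -> F z = laplace (cpulse_sum S T k) z.
  by move=> z0; exact: (laplace_cpulse_sum eta0 gp S8 S12 z0).
have Cplus_eta (z : R[i]) : Cplus z -> - eta < complex.Re z.
  by move=> z0; apply: lt_trans z0; rewrite oppr_lt0.
have Omega_eta (z : R[i]) : Omega M z -> - eta < complex.Re z.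
  move=> [zM _]; apply: lt_trans zM; rewrite ltrN2; apply: le_lt_trans Mieta.
  by rewrite lef_pV2 ?posrE ?Mpos//; apply: Mmono.
exists 2^-1, (1 + (K 0)^-1), (cpulse_sum S T k); split.
- by rewrite invr_gt0 ltr0n addr_gt0// invr_gt0.
- split.
    exact: (locally_integrable_cpulse_sum gp S8 S12 T12).
  exact: (bounded_weak_derivative_cpulse_sum gp S8 S12 T12).
- exists F; split.
  + split=> // z [/Omega_eta|/Cplus_eta]; exact: dF.
  + apply: continuous_in_subspaceT => z /set_mem zA.
    apply/differentiable_continuous/derivable1_diffP/dF.
    case: zA => [cz|/Cplus_eta//].
    by apply: lt_le_trans (closure_Omega_Re Mpos Mmono cz); rewrite ltrN2.
  + move=> z Oz; have /ltW zeta := Omega_eta z Oz.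
    exact: (transform_sum_growth eta0 gp S12 Kpos Mpos Kmono Mmono zeta Oz).
- rewrite limf_esupE; apply: le_ereal_inf_tmp => _ [A [B [_ BA]] <-].
  have [n Bn] := pulse_times_unbounded gp T12 B.
  apply: le_ereal_sup_tmp; eexists; first by exists (T n); [exact: BA|reflexivity].
  rewrite lee_fin.
  have peakn := cpulse_sum_peak gp S8 S12 T12 n.
  set L := M_log M _.
  have Lm : nondecreasing0 L by exact: M_log_nondecreasing.
  have LS : L (S n) = c1 * T n.
    by rewrite /L /M_log max_r ?(gp_e (gp n))// (gp_time (gp n)).
  have L0 : L 0 <= c1 * T n by rewrite -LS; apply: Lm => //; exact: ltW.
  have [r0 _ rmax] := rcinvK (M_log_continuous Kcont Mcont) Lm
    (M_log_unbounded Kpos Mpos Kmono Mmono) L0.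
  have rS := rmax _ (ltW (S0 n)) LS.
  apply: (@le_trans _ _ (S n * (2^-1 * (S n)^-1))).
    by rewrite mulrCA divff ?gt_eqF// mulr1.
  apply: ler_pM => //; first exact: ltW.
  by rewrite mulr_ge0// invr_ge0 ltW.
- exists eta, F; split => //; split=> // z [[zeta _]|/Cplus_eta]; exact: dF.
Qed.
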